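(* Let $\mathcal{H}$ be a Hilbert space with orthonormal basis $\{e_n\}_{n\ge0}$, and let $\Lambda:\mathcal{H}\to\mathcal{B}(\mathcal{H})$ satisfy the canonical anticommutation relations: for all $u,v\in\mathcal{H}$, $\Lambda(u)\Lambda(v)+\Lambda(v)\Lambda(u)=0$ and $\Lambda(u)\Lambda(v)^*+\Lambda(v)^*\Lambda(u)=(u,v)I$. Put $C_n=\Lambda(e_n)$. For $\alpha=(\alpha_0,\alpha_1,\ldots)\in\ell^2$ let $\Gamma_\alpha=[\alpha_{i+j}C_{i+j}]_{i,j\ge0}$, regarded as a bounded operator on $\ell^2(\mathcal{H})$, let $S\in\mathcal{B}(\ell^2(\mathcal{H}))$ be the unilateral forward shift $S(x_0,x_1,\ldots)=(0,x_0,x_1,\ldots)$, and let $$R(\Gamma_\alpha)=\begin{bmatrix}S^* & \Gamma_\alpha\\ 0 & S\end{bmatrix},\qquad R(0)=S^*\oplus S\qquad\text{in }\mathcal{B}(\ell^2(\mathcal{H})\oplus\ell^2(\mathcal{H})).$$ Then $R(\Gamma_\alpha)$ is similar to a contraction if and only if there is a constant $s$ such that for every $N\in\mathbb{N}$ and all $x_0,\ldots,x_N\in\{0\}\oplus(\mathcal{H}\oplus\{0\}\oplus\{0\}\oplus\cdots)$, $$\Big\|\sum_{n=0}^{N}\big(R(\Gamma_\alpha)^n-R(0)^n\big)x_n\Big\|\le s\Big(\sum_{n=0}^N\|x_n\|^2\Big)^{1/2}$$ (i.e. $R(\Gamma_\alpha)$ is quadratically near $S^*\oplus S$ modulo $\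mathcal{H}$).
   Context: An operator is similar to a contraction if it is conjugate by an invertible operator to an operator of norm at most 1. *)

(* Defs.v *)
From mathcomp Require Import all_boot all_order all_algebra.
From mathcomp Require Export complex.
From mathcomp Require Export boolp classical_sets reals.
Import GRing.Theory Num.Theory.

Set Implicit Arguments.
Unset Strict Implicit.
Unset Printing Implicit Defensive.

Local Open Scope ring_scope.

Section Hilbert.
Variable R : realType.
Variable H : lmodType R[i].
(* inner product (u,v): linear in u, conjugate-linear in v *)
Variable ip : H -> H -> R[i].

Definition hnorm (x : H) : R := Num.sqrt (complex.Re (ip x x)).

Record is_hilbert : Prop := {
  ip_linl : forall (a : R[i]) (x y z : H), ip (a *: x + y) z = a * ip x z + ip y z;
  ip_conj : forall x y : H, ip y x = conjc (ip x y);
  ip_ge0  : forall x : H, 0 <= ip x x;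
  ip_eq0  : forall x : H, ip x x = 0 -> x = 0;
  ip_complete : forall u : nat -> H,
     (forall eps : R, 0 < eps -> exists N, forall m n, (N <= m)%N -> (N <= n)%N ->
        hnorm (u m - u n) < eps) ->
     exists l : H, forall eps : R, 0 < eps -> exists N, forall n, (N <= n)%N ->
        hnorm (u n - l) < eps }.

Definition orthonormal_basis (e : nat -> H) : Prop :=
  (forall m n, ip (e m) (e n) = (m == n)%:R) /\
  (forall x : H, (forall n, ip x (e n) = 0) -> x = 0).

Definition bounded_opH (A : H -> H) : Prop :=
  (forall (a : R[i]) (x y : H), A (a *: x + y) = a *: A x + A y) /\
  exists M : R, forall x, hnorm (A x) <= M * hnorm x.

Definition is_adjoint (A B : H -> H) : Prop :=
  forall x y : H, ip (A x) y = ip x (B y).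

(* canonical anticommutation relations for Lambda, with Lambda(v)^* = Lstar v *)
Definition CAR (L Lstar : H -> H -> H) : Prop :=
  (forall u v x, L u (L v x) + L v (L u x) = 0) /\
  (forall u v x, L u (Lstar v x) + Lstar v (L u x) = ip u v *: x).

Definition cvgH (u : nat -> H) (l : H) : Prop :=
  forall eps : R, 0 < eps -> exists N, forall n, (N <= n)%N -> hnorm (u n - l) < eps.
Definition limH (u : nat -> H) : H := xget 0 [set l | cvgH u l].

Definition seqH := nat -> H.
Definition l2H (x : seqH) : Prop :=
  exists M : R, forall N, \sum_(n < N) hnorm (x n) ^+ 2 <= M.
Definition l2sq (x : seqH) : R :=
  sup [set \sum_(n < N) hnorm (x n) ^+ 2 | N in [set: nat]].

Definition KH := (seqH * seqH)%type.
Definition inK (p : KH) : Prop := l2H p.1 /\ l2H p.2.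
Definition knorm (p : KH) : R := Num.sqrt (l2sq p.1 + l2sq p.2).
Definition kadd (p q : KH) : KH :=
  (fun n => p.1 n + q.1 n, fun n => p.2 n + q.2 n).
Definition kscale (a : R[i]) (p : KH) : KH :=
  (fun n => a *: p.1 n, fun n => a *: p.2 n).
Definition ksub (p q : KH) : KH :=
  (fun n => p.1 n - q.1 n, fun n => p.2 n - q.2 n).
Definition k0 : KH := (fun _ => 0, fun _ => 0).

Definition bounded_opK (T : KH -> KH) : Prop :=
  (forall p, inK p -> inK (T p)) /\
  (forall (a : R[i]) p q, inK p -> inK q -> T (kadd (kscale a p) q) = kadd (kscale a (T p)) (T q)) /\
  exists M : R, forall p, inK p -> knorm (T p) <= M * knorm p.

Definition similar_to_contraction (T : KH -> KH) : Prop :=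
  exists W Winv : KH -> KH,
    [/\ bounded_opK W, bounded_opK Winv,
        (forall p, inK p -> W (Winv p) = p /\ Winv (W p) = p) &
        (forall p, inK p -> knorm (W (T (Winv p))) <= knorm p)].

Definition shiftS (x : seqH) : seqH := fun n => if n is k.+1 then x k else 0.
Definition shiftSadj (x : seqH) : seqH := fun n => x n.+1.

(* the Hankel operator Gamma_alpha = [alpha_{i+j} C_{i+j}]_{i,j}, C_n = Lambda(e_n) *)
Definition Gamma (alpha : nat -> R[i]) (C : nat -> H -> H) (x : seqH) : seqH :=
  fun i => limH (fun M => \sum_(j < M) alpha (i + j)%N *: C (i + j)%N (x j)).

(* R(Gamma) = [[S^*, Gamma],[0, S]] and R(0) = S^* (+) S *)
Definition RG (G : seqH -> seqH) (p : KH) : KH :=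
  (fun n => shiftSadj p.1 n + G p.2 n, shiftS p.2).
Definition R0 (p : KH) : KH := (shiftSadj p.1, shiftS p.2).

Definition in_modH (p : KH) : Prop :=
  (forall n, p.1 n = 0) /\ (forall n, (0 < n)%N -> p.2 n = 0).

Definition quad_near_modH (T : KH -> KH) : Prop :=
  exists s : R, forall (N : nat) (x : nat -> KH),
    (forall n, (n <= N)%N -> in_modH (x n)) ->
    knorm (\big[kadd/k0]_(n < N.+1) ksub (iter n T (x n)) (iter n R0 (x n)))
      <= s * Num.sqrt (\sum_(n < N.+1) knorm (x n) ^+ 2).

End Hilbert.

Definition l2C (R : realType) (alpha : nat -> R[i]) : Prop :=
  exists M : R, forall N, \sum_(n < N) complex.Re (alpha n * conjc (alpha n)) <= M.

(* Main.v *)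
Require Import Defs.
From mathcomp Require Import all_boot all_order all_algebra.
From mathcomp Require Import complex boolp classical_sets reals.
From mathcomp Require Import functions topology normedtype sequences.
From mathcomp Require Import ring lra zify.

(** Both properties are equivalent to [sum_k (k+1)^2 |alpha_k|^2 < oo].

    Sufficiency.  The anticommutation relations give the Nehari-type bound
    [||Gamma_beta|| <= ||beta||_2]; truncating the symbol and summing by parts
    in the row index bounds [X = D S Gamma_alpha], [D = diag(0,1,2,...)].  As
    [S^* X - X S = Gamma_alpha], conjugation by [[1 X][0 1]] turns [R(Gamma_alpha)]
    into [S^* (+) S].  The operator [[(j+1) alpha_{i+j} C_{i+j}]] of quadratic
    nearness is bounded likewise, because [j+1 = (i+j+1) - i].

    Necessity.  Let [D_n] be matrices satisfying the Clifford relations and [T] a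
    contraction.  Positivity of the Toeplitz kernel of [T] gives
    [||sum_n b_n D_n (x) T^n||^2 <= 2 sum_n |b_n|^2], so similarity to a
    contraction bounds [sum_n b_n (n+1) alpha_n D_n (x) C_n] by a constant times
    [||b||_2]; quadratic nearness does so directly.  Choose a nonzero vector [h]
    on which [D_n] acts as [C_n + C_n^*].  There [D_n (x) C_n] acts as
    [C_n C_n^*], whose quadratic form at [h] is half of [||h||^2], and
    [b_n = (n+1) conj(alpha_n)] yields a bound on [sum_n (n+1)^2 |alpha_n|^2]. *)

Set Implicit Arguments.
Unset Strict Implicit.
Unset Printing Implicit Defensive.

Import Order.TTheory GRing.Theory Num.Theory.
Import numFieldNormedType.Exports.

Local Open Scope ring_scope.
Local Open Scope classical_set_scope.

(** * Squared modulus of a complex number *)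

Section ComplexModulus.
Variable R : realType.
Implicit Types a b : R[i].

Definition sqmod a : R := complex.Re (a * conjc a).

Lemma sqmodE a : sqmod a = complex.Re a ^+ 2 + complex.Im a ^+ 2.
Proof. by case: a => x y; rewrite /sqmod /=; ring. Qed.

Lemma sqmod_ge0 a : 0 <= sqmod a.
Proof. by rewrite sqmodE addr_ge0 ?sqr_ge0. Qed.

Lemma sqmod0 : sqmod 0 = 0.
Proof. by rewrite /sqmod mul0r. Qed.

Lemma sqmod_conj a : sqmod (conjc a) = sqmod a.
Proof. by rewrite !sqmodE; case: a => x y /=; ring. Qed.

Lemma sqmodM a b : sqmod (a * b) = sqmod a * sqmod b.
Proof. by rewrite !sqmodE; case: a => x y; case: b => z t /=; ring. Qed.

Lemma sqmod_nat n : sqmod n%:R = n%:R ^+ 2.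
Proof. by rewrite sqmodE -(rmorph_nat (real_complex R)) /= expr0n addr0. Qed.

Lemma mul_conjc a : a * conjc a = (sqmod a)%:C%C.
Proof.
rewrite sqmodE; case: a => x y.
by apply/eqP; rewrite eq_complex /=; apply/andP; split; apply/eqP; ring.
Qed.

Lemma conjc_sign (c : bool) : conjc ((-1) ^+ c) = (-1) ^+ c :> R[i].
Proof. by rewrite rmorphXn rmorphN1. Qed.

Lemma sqmod_sign (c : bool) : sqmod ((-1) ^+ c) = 1.
Proof. by rewrite /sqmod conjc_sign -signr_addb addbb expr0. Qed.

End ComplexModulus.

(** * Real inner product, norm and Cauchy-Schwarz *)

Section InnerProduct.
Variables (R : realType) (H : lmodType R[i]) (ip : H -> H -> R[i]).
Hypothesis hH : is_hilbert ip.
Implicit Types (x y z : H) (a b : R[i]).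

(** The real part already determines norms and equality of vectors, and keeps all estimates in the
    ordered field [R]. *)
Definition rip x y : R := complex.Re (ip x y).

Lemma ripC x y : rip x y = rip y x.
Proof. by rewrite /rip (ip_conj hH x y); case: (ip x y). Qed.

Lemma ripDl x y z : rip (x + y) z = rip x z + rip y z.
Proof.
rewrite /rip -{1}[x]scale1r (ip_linl hH) mul1r.
by case: (ip x z); case: (ip y z).
Qed.

Lemma ripDr x y z : rip x (y + z) = rip x y + rip x z.
Proof. by rewrite ripC ripDl !(ripC x). Qed.

Lemma rip0l y : rip 0 y = 0.
Proof. by apply: (addrI (rip 0 y)); rewrite -ripDl !addr0. Qed.

Lemma rip0r x : rip x 0 = 0.
Proof. by rewrite ripC rip0l. Qed.

Lemma ipZl a x y : ip (a *: x) y = a * ip x y.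
Proof.
have ip0 : ip 0 y = 0.
  by have := ip_linl hH (-1) x x y; rewrite scaleN1r addNr mulN1r addNr.
by rewrite -[a *: x]addr0 (ip_linl hH) ip0 addr0.
Qed.

Lemma ripZ a x y : rip (a *: x) y = rip x (conjc a *: y).
Proof.
rewrite [RHS]ripC /rip !ipZl (ip_conj hH x y).
by case: a => s t; case: (ip x y) => u v /=; ring.
Qed.

Lemma ripNl x y : rip (- x) y = - rip x y.
Proof. by apply/eqP; rewrite -addr_eq0 -ripDl addNr rip0l. Qed.

Lemma ripNr x y : rip x (- y) = - rip x y.
Proof. by rewrite ripC ripNl ripC. Qed.

Lemma rip_suml (I : Type) (s : seq I) (P : pred I) (F : I -> H) y :
  rip (\sum_(i <- s | P i) F i) y = \sum_(i <- s | P i) rip (F i) y.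
Proof.
by elim/big_rec2: _ => [|i u v _ <-]; rewrite ?rip0l ?ripDl.
Qed.

Lemma rip_sumr (I : Type) (s : seq I) (P : pred I) (F : I -> H) x :
  rip x (\sum_(i <- s | P i) F i) = \sum_(i <- s | P i) rip x (F i).
Proof. by rewrite ripC rip_suml; apply: eq_bigr => i _; rewrite ripC. Qed.

Definition sqn x : R := rip x x.

Lemma sqn_ge0 x : 0 <= sqn x.
Proof. by have := ip_ge0 hH x; rewrite lecE /= => /andP[]. Qed.

Lemma hnormE x : hnorm ip x = Num.sqrt (sqn x). Proof. by []. Qed.

Lemma hnorm_sqr x : hnorm ip x ^+ 2 = sqn x.
Proof. by rewrite sqr_sqrtr ?sqn_ge0. Qed.

Lemma hnorm_ge0 x : 0 <= hnorm ip x.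
Proof. exact: sqrtr_ge0. Qed.

Lemma sqn_eq0 x : sqn x = 0 -> x = 0.
Proof.
move=> x0; apply: (ip_eq0 hH); have := ip_ge0 hH x; rewrite lecE /= => /andP[/eqP im _].
by move: x0 im; rewrite /sqn /rip; case: (ip x x) => u v /= -> ->.
Qed.

Lemma sqn0 : sqn 0 = 0. Proof. exact: rip0l. Qed.

Lemma sqnD x y : sqn (x + y) = sqn x + 2 * rip x y + sqn y.
Proof. by rewrite /sqn ripDl !ripDr (ripC y x); ring. Qed.

Lemma sqnN x : sqn (- x) = sqn x.
Proof. by rewrite /sqn ripNl ripNr opprK. Qed.

Lemma sqnB x y : sqn (x - y) = sqn x - 2 * rip x y + sqn y.
Proof. by rewrite sqnD sqnN ripNr; ring. Qed.

Lemma ripRZ (t : R) x y : rip (t%:C%C *: x) y = t * rip x y.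
Proof. by rewrite /rip ipZl; case: (ip x y) => u v /=; ring. Qed.

Lemma ripRZr (t : R) x y : rip x (t%:C%C *: y) = t * rip x y.
Proof. by rewrite ripC ripRZ ripC. Qed.

Lemma ripZZ a x y : rip (a *: x) (a *: y) = sqmod a * rip x y.
Proof.
by rewrite ripC ripZ scalerA mulrC mul_conjc ripRZr ripC.
Qed.

Lemma sqnZ a x : sqn (a *: x) = sqmod a * sqn x.
Proof. exact: ripZZ. Qed.

Lemma sqnD_le x y : sqn (x + y) <= 2 * sqn x + 2 * sqn y.
Proof. by have := sqn_ge0 (x - y); rewrite sqnB sqnD; lra. Qed.

Lemma cauchy_schwarz x y : rip x y <= hnorm ip x * hnorm ip y.
Proof.
have [xy0|xy0] := lerP (rip x y) 0.
  by apply: le_trans xy0 _; rewrite mulr_ge0 ?hnorm_ge0.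
rewrite -ler_sqr ?nnegrE ?mulr_ge0 ?hnorm_ge0 //; last exact: ltW.
rewrite exprMn !hnorm_sqr.
have [y0|yn0] := eqVneq (sqn y) 0.
  by move: xy0; rewrite (sqn_eq0 y0) rip0r ltxx.
have ypos : 0 < sqn y by rewrite lt_neqAle eq_sym yn0 sqn_ge0.
pose t := rip x y / sqn y.
have := sqn_ge0 (x - t%:C%C *: y).
rewrite sqnB ripRZr /sqn ripRZ ripRZr -/(sqn x) -/(sqn y).
have -> : sqn x - 2 * (t * rip x y) + t * (t * sqn y) = sqn x - rip x y ^+ 2 / sqn y.
  by rewrite /t; field.
by rewrite subr_ge0 ler_pdivrMr.
Qed.

Lemma hnorm_leD x y : hnorm ip (x + y) <= hnorm ip x + hnorm ip y.
Proof.
rewrite -ler_sqr ?nnegrE ?addr_ge0 ?hnorm_ge0 // hnorm_sqr sqnD sqrrD !hnorm_sqr.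
by have := cauchy_schwarz x y; lra.
Qed.

Lemma hnorm0 : hnorm ip 0 = 0.
Proof. by rewrite hnormE sqn0 sqrtr0. Qed.

Lemma hnorm_sum (I : Type) (s : seq I) (P : pred I) (F : I -> H) :
  hnorm ip (\sum_(i <- s | P i) F i) <= \sum_(i <- s | P i) hnorm ip (F i).
Proof.
elim/big_rec2: _ => [|i u v _ IH]; first by rewrite hnorm0.
by apply: le_trans (hnorm_leD _ _) _; rewrite lerD2l.
Qed.

Lemma hnorm_opp x : hnorm ip (- x) = hnorm ip x.
Proof. by rewrite !hnormE sqnN. Qed.

Lemma rip_eq x y : (forall z, rip z x = rip z y) -> x = y.
Proof.
move=> h; apply/eqP; rewrite -subr_eq0; apply/eqP/sqn_eq0.
by rewrite /sqn ripDr ripNr h subrr.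
Qed.

End InnerProduct.

(** * Consequences of the anticommutation relations *)

Section CARFamily.
Variables (R : realType) (H : lmodType R[i]) (ip : H -> H -> R[i]).
Hypothesis hH : is_hilbert ip.
Local Notation rip := (rip ip).
Local Notation sqn := (sqn ip).

(** The index type is arbitrary so that the relations can be transported to a cyclic group of
    indices. Linearity of [Cs] and its own anticommutation follow from adjointness by duality. *)
Definition car_family (I : eqType) (C Cs : I -> H -> H) : Prop :=
  [/\ forall i (a : R[i]) x y, C i (a *: x + y) = a *: C i x + C i y,
      forall i, is_adjoint ip (C i) (Cs i),
      forall i j x, C i (C j x) + C j (C i x) = 0 &
      forall i j x, C i (Cs j x) + Cs j (C i x) = (i == j)%:R *: x].

Variables (I : eqType) (C Cs : I -> H -> H).
Hypothesis car : car_family C Cs.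
Implicit Types (i j : I) (x y : H) (a : R[i]).

Lemma car_rip i x y : rip (C i x) y = rip x (Cs i y).
Proof. by case: car => _ adj _ _; rewrite /rip adj. Qed.

Lemma car_ripr i x y : rip y (C i x) = rip (Cs i y) x.
Proof. by rewrite (ripC hH) car_rip (ripC hH). Qed.

Lemma carD i x y : C i (x + y) = C i x + C i y.
Proof. by case: car => lin _ _ _; rewrite -[x in LHS]scale1r lin scale1r. Qed.

Lemma car0 i : C i 0 = 0.
Proof. by apply: (addrI (C i 0)); rewrite -carD !addr0. Qed.

Lemma carZ i a x : C i (a *: x) = a *: C i x.
Proof. by case: car => lin _ _ _; rewrite -[a *: x]addr0 lin car0 addr0. Qed.

Lemma carN i x : C i (- x) = - C i x.
Proof. by rewrite -scaleN1r carZ scaleN1r. Qed.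

Lemma carsD i x y : Cs i (x + y) = Cs i x + Cs i y.
Proof. by apply: (rip_eq hH) => z; rewrite -car_rip !(ripDr hH) !car_rip. Qed.

Lemma cars0 i : Cs i 0 = 0.
Proof. by apply: (addrI (Cs i 0)); rewrite -carsD !addr0. Qed.

Lemma carsZ i a x : Cs i (a *: x) = a *: Cs i x.
Proof.
apply: (rip_eq hH) => z; rewrite -car_rip -[a]conjcK -!(ripZ hH).
by rewrite -car_rip carZ.
Qed.

Lemma carsN i x : Cs i (- x) = - Cs i x.
Proof. by rewrite -scaleN1r carsZ scaleN1r. Qed.

Lemma car_anti i j x : C i (C j x) = - C j (C i x).
Proof. by case: car => _ _ anti _; apply/eqP; rewrite -addr_eq0 anti. Qed.

Lemma cars_anti i j x : Cs i (Cs j x) = - Cs j (Cs i x).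
Proof.
apply: (rip_eq hH) => z; rewrite (ripNr hH) -!car_rip car_anti.
by rewrite (ripNl hH).
Qed.

Lemma car_mix i j x : C i (Cs j x) = (i == j)%:R *: x - Cs j (C i x).
Proof. by case: car => _ _ _ rel; rewrite -(rel i j x) addrK. Qed.

Lemma car_sq i x : C i (C i x) = 0.
Proof.
have /eqP := car_anti i i x; rewrite -subr_eq0 opprK -mulr2n -scaler_nat.
by rewrite scaler_eq0 pnatr_eq0 /= => /eqP.
Qed.

Lemma cars_sq i x : Cs i (Cs i x) = 0.
Proof.
have /eqP := cars_anti i i x; rewrite -subr_eq0 opprK -mulr2n -scaler_nat.
by rewrite scaler_eq0 pnatr_eq0 /= => /eqP.
Qed.

(** Evaluate the quadratic form of [C_i C_i^* + C_i^* C_i = 1] at [x]. *)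
Lemma car_sqn i x : sqn (C i x) + sqn (Cs i x) = sqn x.
Proof.
rewrite /sqn car_rip -[in X in _ + X]car_ripr -(ripDr hH) addrC car_mix eqxx.
by rewrite scale1r subrK.
Qed.

Lemma car_le i x : sqn (C i x) <= sqn x.
Proof. by rewrite -(car_sqn i x) lerDl (sqn_ge0 hH). Qed.

(** With the operators moved to one side, the two terms are the two orders of the product of [C i]
    and [Cs j], with the same scalar [a * conjc b], so the mixed relation collapses their sum. *)
Lemma car_cross i j a b x y :
  rip (a *: C i x) (b *: C j y) + rip (conjc b *: Cs j x) (conjc a *: Cs i y)
    = (i == j)%:R * rip (a *: x) (b *: y).
Proof.
rewrite !(ripZ hH) conjcK !scalerA [b * _]mulrC -!carZ -carsZ.
rewrite car_ripr -[X in _ + X]car_rip -(ripDl hH) addrC car_mix subrK.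
by case: (i == j); rewrite ?mul1r ?mul0r ?scale1r ?scale0r ?(rip0l hH).
Qed.

End CARFamily.

(** * Hankel matrices indexed by a finite abelian group *)

Section GroupHankel.
Variables (R : realType) (H : lmodType R[i]) (ip : H -> H -> R[i]).
Hypothesis hH : is_hilbert ip.
Local Notation rip := (rip ip).
Local Notation sqn := (sqn ip).

(* The companion matrix with entries [conj b_(-(i+j)) Cs_(-(i+j))] turns the
   inequality into an equality: after the substitution [i := -(i+j+l)] the cross
   terms of the two matrices add up to an anticommutator. *)
Lemma group_hankel (G : finZmodType) (C Cs : G -> H -> H) (b : G -> R[i])
    (y : G -> H) : car_family ip C Cs ->
  \sum_i sqn (\sum_j b (i + j) *: C (i + j) (y j))
    <= (\sum_k sqmod (b k)) * \sum_j sqn (y j).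
Proof.
move=> car.
pose V i := \sum_j conjc (b (- (i + j))) *: Cs (- (i + j)) (y j).
suff : \sum_i sqn (\sum_j b (i + j) *: C (i + j) (y j)) + \sum_i sqn (V i)
    = (\sum_k sqmod (b k)) * \sum_j sqn (y j).
  by move=> <-; rewrite lerDl sumr_ge0 // => i _; exact: sqn_ge0.
have expand (A : G -> G -> H) :
    \sum_i sqn (\sum_j A i j) = \sum_j \sum_l \sum_i rip (A i j) (A i l).
  under eq_bigr => i _ do rewrite /sqn (rip_suml hH).
  rewrite exchange_big; apply: eq_bigr => j _ /=.
  under eq_bigr => i _ do rewrite (rip_sumr hH).
  by rewrite exchange_big.
rewrite !expand -big_split mulr_sumr; apply: eq_bigr => j _ /=.
rewrite -big_split (bigD1 j) //= [X in _ + X]big1 ?addr0; last first.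
  move=> l lj; pose h i : G := - (i + j + l).
  have hK : involutive h.
    by move=> i; rewrite /h !opprD !opprK [_ - j - l]addrAC !addrK.
  rewrite [X in _ + X](reindex_inj (inv_inj hK)) -big_split big1 // => i _ /=.
  rewrite ![- (h i + _)]opprD opprK addrK [_ + l - j]addrAC addrK.
  by rewrite (car_cross hH car) (inj_eq (addrI i)) eq_sym (negPf lj) mul0r.
have hK : involutive (fun i : G => - (i + j + j)).
  by move=> i; rewrite !opprD !opprK !addrK.
rewrite [X in _ + X](reindex_inj (inv_inj hK)) -big_split /=.
rewrite [in RHS](reindex_inj (addIr j)) mulr_suml; apply: eq_bigr => i _ /=.
by rewrite !opprD !opprK !addrK (car_cross hH car) eqxx mul1r (ripZZ hH).
Qed.
End GroupHankel.

Lemma car_family_inj (R : realType) (H : lmodType R[i]) (ip : H -> H -> R[i])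
    (I J : eqType) (f : I -> J) (C Cs : J -> H -> H) : injective f ->
  car_family ip C Cs -> car_family ip (fun i => C (f i)) (fun i => Cs (f i)).
Proof.
move=> finj [lin adj anti rel]; split=> // i j x.
by rewrite rel (inj_eq finj).
Qed.

(** * Finite Hankel matrices over the naturals, plain and with weighted rows *)

Section Hankel.
Variables (R : realType) (H : lmodType R[i]) (ip : H -> H -> R[i]).
Hypothesis hH : is_hilbert ip.
Variables C Cs : nat -> H -> H.
Hypothesis car : car_family ip C Cs.
Local Notation sqn := (sqn ip).

Lemma hankel_bound (c : nat -> R[i]) (N M : nat) (x : nat -> H) :
  \sum_(i < N) sqn (\sum_(j < M) c (i + j)%N *: C (i + j)%N (x j))
    <= (\sum_(k < N + M) sqmod (c k)) * \sum_(j < M) sqn (x j).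
Proof.
case: (posnP (N + M)) => [|NM_gt0].
  by move/eqP; rewrite addn_eq0 => /andP[/eqP-> /eqP->]; rewrite !big_ord0 mul0r.
(* ['I_L.+1] is the cyclic group of order [N + M]. For [i < N] and [j < M] the sum [i + j] does not
   wrap around, so the group Hankel matrix contains the wanted block. *)
pose L := (N + M).-1; have LE : L.+1 = (N + M)%N by rewrite prednK.
pose y (j : 'I_L.+1) := if (j < M)%N then x j else 0.
have carL := car_family_inj (@ord_inj L.+1) car.
have := group_hankel hH (fun k : 'I_L.+1 => c k) y carL.
have MS : (M <= L.+1)%N by rewrite LE leq_addl.
have NS : (N <= L.+1)%N by rewrite LE leq_addr.
have -> : \sum_(j < M) sqn (x j) = \sum_j sqn (y j).
  rewrite (big_ord_widen L.+1 (fun j => sqn (x j)) MS) big_mkcond.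
  by apply: eq_bigr => j _; rewrite /y; case: ifP => // _; rewrite (sqn0 hH).
rewrite -LE; apply: le_trans.
rewrite (big_ord_widen L.+1 (fun i => sqn (\sum_(j < M) c (i + j)%N *: C (i + j)%N (x j))) NS).
rewrite big_mkcond; apply: ler_sum => i _; case: ifP => [iN|_]; last exact: sqn_ge0.
rewrite (big_ord_widen L.+1 (fun j => c (i + j)%N *: C (i + j)%N (x j)) MS).
rewrite big_mkcond le_eqVlt; apply/orP; left; apply/eqP; congr sqn.
apply: eq_bigr => j _; rewrite /y; case: ifP => [jM|_]; last first.
  by rewrite (car0 carL) scaler0.
have -> : val (i + j) = (i + j)%N :> nat; last by [].
by rewrite /= modn_small //; lia.
Qed.

Lemma weighted_hankel_bound (c : nat -> R[i]) (A : R) (N M : nat) (x : nat -> H) :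
  (forall n, \sum_(k < n) k.+1%:R ^+ 2 * sqmod (c k) <= A) ->
  \sum_(i < N) i.+1%:R ^+ 2 * sqn (\sum_(j < M) c (i + j)%N *: C (i + j)%N (x j))
    <= A * \sum_(j < M) sqn (x j).
Proof.
move=> hA; set B := \sum_(j < M) _.
have B0 : 0 <= B by apply: sumr_ge0 => j _; exact: sqn_ge0.
pose P := (N + M)%N.
(* Abel summation, from [(n+1)^2 = sum_(r <= n) (2r+1)] *)
have E (n : nat) (f : nat -> R) : (n <= P)%N -> \sum_(i < n) i.+1%:R ^+ 2 * f i
    = \sum_(r < P) (r.*2.+1)%:R * \sum_(i < n) (r <= i)%:R * f i.
  move=> nP; under [RHS]eq_bigr => r _ do rewrite mulr_sumr.
  rewrite exchange_big /=; apply: eq_bigr => i _.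
  under [RHS]eq_bigr => r _ do rewrite mulrA mulr_natr mulrb.
  rewrite -mulr_suml; congr (_ * _); rewrite -big_mkcond /=.
  have iP : (i < P)%N by apply: leq_trans nP.
  rewrite -(big_ord_widen P (fun r => (r.*2.+1)%:R) iP).
  elim: (val i) => [|m IH]; first by rewrite big_ord1 expr1n.
  rewrite big_ord_recr -IH /= -[m.+2%:R]natr1 -[(_.*2).+1%:R]natr1 -muln2 natrM.
  by rewrite -[m.+1%:R]natr1; ring.
apply: le_trans (_ : (\sum_(k < P) k.+1%:R ^+ 2 * sqmod (c k)) * B <= _); last first.
  by rewrite ler_wpM2r.
rewrite (E _ (fun i => sqn (\sum_(j < M) c (i + j)%N *: C (i + j)%N (x j)))) ?leq_addr //.
rewrite (E _ (fun k => sqmod (c k))) // mulr_suml; apply: ler_sum => r _.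
rewrite -mulrA ler_wpM2l ?ler0n //.
(* Rows [i >= r] only involve [c k] with [k >= r], so cutting [c] below [r] leaves them unchanged,
   while the plain bound then sees only the tail of the symbol. *)
pose cr k := if (r <= k)%N then c k else 0.
have := hankel_bound cr N M x; rewrite -/P -/B.
have -> : \sum_(k < P) sqmod (cr k) = \sum_(k < P) (r <= k)%:R * sqmod (c k).
  by apply: eq_bigr => k _; rewrite /cr; case: ifP; rewrite ?mul1r ?mul0r ?sqmod0.
apply: le_trans; apply: ler_sum => i _; have [ri|_] := leqP r i; last first.
  by rewrite mul0r (sqn_ge0 hH).
rewrite mul1r le_eqVlt; apply/orP; left; apply/eqP; congr sqn.
by apply: eq_bigr => j _; rewrite /cr ifT // (leq_trans ri) ?leq_addr.
Qed.
End Hankel.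

(** * Limits in the Hilbert space *)

Section Limits.
Variables (R : realType) (H : lmodType R[i]) (ip : H -> H -> R[i]).
Hypothesis hH : is_hilbert ip.
Local Notation sqn := (sqn ip).
Implicit Types (u v : nat -> H) (l : H).

Lemma hnorm_eq0 (x : H) : hnorm ip x = 0 -> x = 0.
Proof.
move=> x0; apply: (sqn_eq0 hH).
by rewrite -(hnorm_sqr hH) x0 expr0n.
Qed.

Lemma hnorm_scale (a : R[i]) (x : H) : hnorm ip (a *: x) = Num.sqrt (sqmod a) * hnorm ip x.
Proof. by rewrite !hnormE (sqnZ hH) sqrtrM ?sqmod_ge0. Qed.

Lemma cvgH_unique u l l' : cvgH ip u l -> cvgH ip u l' -> l = l'.
Proof.
move=> ul ul'; apply/eqP; rewrite -subr_eq0; apply/eqP/hnorm_eq0.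
apply/eqP; rewrite eq_le (hnorm_ge0 ip) andbT leNgt; apply/negP => d0.
have [|N1 h1] := ul (hnorm ip (l - l') / 2); first by rewrite divr_gt0.
have [|N2 h2] := ul' (hnorm ip (l - l') / 2); first by rewrite divr_gt0.
have := h1 (maxn N1 N2) (leq_maxl _ _); have := h2 (maxn N1 N2) (leq_maxr _ _).
set n := maxn _ _.
have -> : l - l' = - (u n - l) + (u n - l') by rewrite opprB addrA subrK.
by have := hnorm_leD hH (- (u n - l)) (u n - l'); rewrite (hnorm_opp hH); lra.
Qed.

Lemma limHE u l : cvgH ip u l -> limH ip u = l.
Proof.
move=> ul; apply: (@cvgH_unique u) => //.
by have /= := xgetPex (0 : H) (ex_intro (fun l => cvgH ip u l) l ul).
Qed.

Lemma cvgH_near u v l : (exists N, forall n, (N <= n)%N -> u n = v n) ->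
  cvgH ip u l -> cvgH ip v l.
Proof.
move=> [N1 uv] ul e e0; have [N hN] := ul e e0; exists (maxn N N1) => n.
by rewrite geq_max => /andP[Nn N1n]; rewrite -uv // hN.
Qed.

Lemma cvgH_cst l : cvgH ip (fun=> l) l.
Proof. by move=> e e0; exists 0%N => n _; rewrite subrr (hnorm0 hH). Qed.

Lemma cvgHD u v l l' : cvgH ip u l -> cvgH ip v l' ->
  cvgH ip (fun n => u n + v n) (l + l').
Proof.
move=> ul vl e e0; have e2 : 0 < e / 2 by rewrite divr_gt0.
have [N1 h1] := ul _ e2; have [N2 h2] := vl _ e2; exists (maxn N1 N2) => n.
rewrite geq_max => /andP[n1 n2]; have := h1 _ n1; have := h2 _ n2.
have -> : u n + v n - (l + l') = (u n - l) + (v n - l').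
  by rewrite opprD addrACA.
by have := hnorm_leD hH (u n - l) (v n - l'); lra.
Qed.

Lemma cvgHZ a u l : cvgH ip u l -> cvgH ip (fun n => a *: u n) (a *: l).
Proof.
move=> ul e e0; set t := Num.sqrt (sqmod a); have t0 : 0 <= t := sqrtr_ge0 _.
have e2 : 0 < e / (t + 1) by rewrite divr_gt0 // ltr_wpDl.
have [N hN] := ul _ e2; exists N => n /hN; rewrite ltr_pdivlMr ?ltr_wpDl //.
by rewrite -scalerBr hnorm_scale -/t; have := hnorm_ge0 ip (u n - l); nra.
Qed.

Lemma cvgH_hnorm u l : cvgH ip u l -> (fun n => hnorm ip (u n)) @ \oo --> hnorm ip l.
Proof.
move=> ul; apply/cvgrPdist_lt => e e0; have [N hN] := ul e e0.
exists N => // n /= /hN; apply: le_lt_trans.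
have h1 := hnorm_leD hH (u n - l) l; have h2 := hnorm_leD hH (l - u n) (u n).
move: h1 h2; rewrite !subrK -(hnorm_opp hH (l - u n)) opprB => h1 h2.
by rewrite ler_norml; apply/andP; split; lra.
Qed.

Lemma cvgH_sqn u l : cvgH ip u l -> (fun n => sqn (u n)) @ \oo --> sqn l.
Proof.
move=> /cvgH_hnorm ul; rewrite -(hnorm_sqr hH) expr2.
under eq_cvg do rewrite -(hnorm_sqr hH) expr2.
exact: cvgM.
Qed.

Lemma cvg_sum_ord (N : nat) (f : nat -> nat -> R) (l : nat -> R) :
  (forall i, f i @ \oo --> l i) ->
  (fun M => \sum_(i < N) f i M) @ \oo --> \sum_(i < N) l i.
Proof.
move=> fl; elim: N => [|N IH].
  by under eq_cvg do rewrite big_ord0; rewrite big_ord0; exact: cvg_cst.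
by under eq_cvg do rewrite big_ord_recr; rewrite big_ord_recr; apply: cvgD.
Qed.

(** Carries bounds for matrices truncated to [M] columns over to the limit, one finite block of rows
    at a time. *)
Lemma cvgH_sum_le (N : nat) (w : nat -> R) (u : nat -> nat -> H) (l : nat -> H) (B : R) :
  (forall i, cvgH ip (u i) (l i)) ->
  (forall M, \sum_(i < N) w i * sqn (u i M) <= B) ->
  \sum_(i < N) w i * sqn (l i) <= B.
Proof.
move=> ul uB.
have h : (fun M => \sum_(i < N) w i * sqn (u i M)) @ \oo --> \sum_(i < N) w i * sqn (l i).
  apply: (@cvg_sum_ord N (fun i M => w i * sqn (u i M)) (fun i => w i * sqn (l i))).
  by move=> i; apply: cvgM; [exact: cvg_cst|exact: cvgH_sqn].
by rewrite -(cvg_lim _ h) //; apply: limr_le; [apply/cvg_ex; eexists; exact: h|exact: nearW].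
Qed.

(** The partial sums of norms are monotone and bounded, hence Cauchy, and their increments dominate
    those of the partial sums of [f]. *)
Lemma cvgH_abs (f : nat -> H) (B : R) :
  (forall n, \sum_(j < n) hnorm ip (f j) <= B) ->
  exists l, cvgH ip (fun n => \sum_(j < n) f j) l.
Proof.
move=> fB; apply: (ip_complete hH) => e e0.
pose s n := \sum_(j < n) hnorm ip (f j).
have s_nd : nondecreasing_seq s.
  by apply/nondecreasing_seqP => n; rewrite /s big_ord_recr lerDl (hnorm_ge0 ip).
have scvg : cvgn s.
  by apply: (nondecreasing_is_cvgn s_nd); exists B => _ [n _ <-]; exact: fB.
have [N _ hN] := (cvgrPdist_lt _ _).1 scvg e e0.
have dist m n : (N <= m)%N -> (m <= n)%N ->
    hnorm ip (\sum_(j < n) f j - \sum_(j < m) f j) < e.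
  move=> Nm mn; have -> : \sum_(j < n) f j - \sum_(j < m) f j = \sum_(m <= j < n) f j.
    rewrite -!(big_mkord xpredT) (big_cat_nat (leq0n m) mn) /=.
    by rewrite addrAC subrr add0r.
  apply: le_lt_trans (hnorm_sum hH _ _ _) _.
  have -> : \sum_(m <= j < n) hnorm ip (f j) = s n - s m.
    rewrite /s -!(big_mkord xpredT (fun j => hnorm ip (f j))) (big_cat_nat (leq0n m) mn) /=.
    by rewrite addrAC subrr add0r.
  have := hN _ Nm; have := hN _ (leq_trans Nm mn).
  have sm := nondecreasing_cvgn_le s_nd scvg m.
  have sn := nondecreasing_cvgn_le s_nd scvg n.
  by rewrite !ger0_norm ?subr_ge0 //; lra.
exists N => m n Nm Nn; have [mn|/ltnW nm] := leqP m n; last exact: dist.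
by rewrite -(hnorm_opp hH) opprB; apply: dist.
Qed.

End Limits.

(** * The space of square-summable sequences *)

Section SquareSummable.
Variables (R : realType) (H : lmodType R[i]) (ip : H -> H -> R[i]).
Hypothesis hH : is_hilbert ip.
Local Notation rip := (rip ip).
Local Notation sqn := (sqn ip).
Local Notation l2sq := (l2sq ip).
Local Notation l2H := (l2H ip).
Implicit Types (x y z : nat -> H).

Definition psum x N := \sum_(n < N) sqn (x n).

Lemma psumE x N : \sum_(n < N) hnorm ip (x n) ^+ 2 = psum x N.
Proof. by apply: eq_bigr => n _; rewrite (hnorm_sqr hH). Qed.

Lemma psum_ge0 x N : 0 <= psum x N.
Proof. by apply: sumr_ge0 => n _; exact: sqn_ge0. Qed.

Lemma l2HP x : l2H x <-> exists M, forall N, psum x N <= M.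
Proof. by split=> -[M hM]; exists M => N; move: (hM N); rewrite psumE. Qed.

Lemma psum_nd x : nondecreasing_seq (psum x).
Proof. by apply/nondecreasing_seqP => n; rewrite /psum big_ord_recr lerDl (sqn_ge0 hH). Qed.

Lemma l2sqE x : l2sq x = sup (range (psum x)).
Proof. by rewrite /Defs.l2sq; congr sup; apply: eq_imagel => N _; rewrite psumE. Qed.

Lemma cvg_l2sq x : l2H x -> psum x @ \oo --> l2sq x.
Proof.
move=> /l2HP[M hM]; rewrite l2sqE; apply: nondecreasing_cvgn (psum_nd x) _.
by exists M => _ [N _ <-].
Qed.

Lemma psum_le x N : l2H x -> psum x N <= l2sq x.
Proof.
move=> /l2HP[M hM]; rewrite l2sqE; apply: ub_le_sup; last by exists N.
by exists M => _ [n _ <-].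
Qed.

Lemma l2sq_le x M : (forall N, psum x N <= M) -> l2sq x <= M.
Proof.
move=> hM; rewrite l2sqE; apply: ge_sup => [|_ [n _ <-] //].
by exists (psum x 0), 0%N.
Qed.

Lemma l2sq_ge0 x : l2H x -> 0 <= l2sq x.
Proof. by move=> hx; apply: le_trans (psum_le 0 hx); exact: psum_ge0. Qed.

Lemma sqn_le_l2sq x n : l2H x -> sqn (x n) <= l2sq x.
Proof.
move=> /(psum_le n.+1); apply: le_trans; rewrite /psum big_ord_recr lerDr.
exact: psum_ge0.
Qed.

Lemma l2H_lin (a : R[i]) x y : l2H x -> l2H y -> l2H (fun n => a *: x n + y n).
Proof.
move=> /l2HP[A hA] /l2HP[B hB]; apply/l2HP; exists (2 * (sqmod a * A) + 2 * B) => N.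
apply: le_trans (_ : 2 * (sqmod a * psum x N) + 2 * psum y N <= _).
  rewrite /psum 3!mulr_sumr -big_split /=; apply: ler_sum => n _.
  by apply: le_trans (sqnD_le hH _ _) _; rewrite (sqnZ hH).
by rewrite lerD // ler_pM2l ?ltr0n ?ler_wpM2l ?sqmod_ge0.
Qed.

Lemma l2H0 : l2H (fun=> 0).
Proof. by apply/l2HP; exists 0 => N; rewrite /psum big1 // => n _; exact: sqn0. Qed.

Lemma l2HZ (a : R[i]) x : l2H x -> l2H (fun n => a *: x n).
Proof.
move=> hx; have -> : (fun n => a *: x n) = (fun n => a *: x n + 0).
  by apply/funext => n; rewrite addr0.
exact: l2H_lin hx l2H0.
Qed.

Lemma l2HD x y : l2H x -> l2H y -> l2H (fun n => x n + y n).
Proof.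
move=> hx hy; have -> : (fun n => x n + y n) = (fun n => 1 *: x n + y n).
  by apply/funext => n; rewrite scale1r.
exact: l2H_lin.
Qed.

Definition srip x y : R := limn (fun N => \sum_(n < N) rip (x n) (y n)).

Lemma cvg_srip x y : l2H x -> l2H y ->
  (fun N => \sum_(n < N) rip (x n) (y n)) @ \oo --> srip x y.
Proof.
move=> hx hy.
(* Polarization reduces convergence to that of partial sums of squared norms. *)
have E N : \sum_(n < N) rip (x n) (y n)
    = 2^-1 * (psum (fun n => x n + y n) N - psum x N - psum y N).
  rewrite /psum -!sumrB mulr_sumr; apply: eq_bigr => n _.
  by rewrite (sqnD hH); field.
suff : cvgn (fun N => \sum_(n < N) rip (x n) (y n)) by [].
under eq_fun do rewrite E.
apply: is_cvgMr; apply: is_cvgB; last by apply/cvg_ex; eexists; exact: cvg_l2sq.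
apply: is_cvgB; apply/cvg_ex; eexists; apply: cvg_l2sq => //; exact: l2HD.
Qed.

Lemma srip_lim x y (l : R) :
  (fun N => \sum_(n < N) rip (x n) (y n)) @ \oo --> l -> srip x y = l.
Proof. exact: cvg_lim. Qed.

Lemma sripC x y : srip x y = srip y x.
Proof.
rewrite /srip; congr (limn _); apply/funext => N.
by apply: eq_bigr => n _; rewrite (ripC hH).
Qed.

Lemma sripZ (a : R[i]) x y :
  srip (fun n => a *: x n) y = srip x (fun n => conjc a *: y n).
Proof.
rewrite /srip; congr (limn _); apply/funext => N.
by apply: eq_bigr => n _; rewrite (ripZ hH).
Qed.

Lemma sripDl x y z : l2H x -> l2H y -> l2H z ->
  srip (fun n => x n + y n) z = srip x z + srip y z.
Proof.
move=> hx hy hz; apply: srip_lim.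
under eq_cvg do (under eq_bigr do rewrite (ripDl hH); rewrite big_split).
by apply: cvgD; apply: cvg_srip.
Qed.

Lemma srip_real (r : R) x y : l2H x -> l2H y ->
  srip (fun n => r%:C%C *: x n) y = r * srip x y.
Proof.
move=> hx hy; apply: srip_lim.
under eq_cvg do (under eq_bigr do rewrite (ripRZ hH); rewrite -mulr_sumr).
by apply: cvgM; [exact: cvg_cst|exact: cvg_srip].
Qed.

Lemma srip_l2sq x : l2H x -> srip x x = l2sq x.
Proof. by move=> /cvg_l2sq; exact: srip_lim. Qed.

End SquareSummable.

(** * The Hankel operator and the powers of [RG G] *)

Section FoguelHankel.
Variables (R : realType) (H : lmodType R[i]) (ip : H -> H -> R[i]).
Hypothesis hH : is_hilbert ip.
Variables C Cs : nat -> H -> H.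
Hypothesis car : car_family ip C Cs.
Variable alpha : nat -> R[i].
Hypothesis alpha_l2 : l2C alpha.
Local Notation sqn := (sqn ip).
Local Notation l2sq := (l2sq ip).
Local Notation l2H := (l2H ip).
Local Notation psum := (psum ip).
Local Notation knorm := (knorm ip).
Local Notation inK := (inK ip).
Local Notation G := (Gamma ip alpha C).
Implicit Types (x y : nat -> H) (p q : KH H).

Lemma sum_shift_le (f : nat -> R) (i n : nat) : (forall k, 0 <= f k) ->
  \sum_(j < n) f (i + j)%N <= \sum_(k < i + n) f k.
Proof.
by move=> f0; rewrite big_split_ord /= lerDr sumr_ge0.
Qed.

Lemma Gamma_cvg x i : l2H x ->
  cvgH ip (fun M => \sum_(j < M) alpha (i + j)%N *: C (i + j)%N (x j)) (G x i).
Proof.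
move=> /(l2HP hH)[B hB]; have [A hA] := alpha_l2.
(* The bound is [s t <= (s^2 + t^2) / 2], with [s] the modulus of [alpha (i + j)] and [t] the norm
   of [C (i + j) (x j)]. *)
have [|l hl] := cvgH_abs hH (f := fun j => alpha (i + j)%N *: C (i + j)%N (x j))
  (B := 2^-1 * A + 2^-1 * B); last by rewrite /Gamma (limHE hH hl).
move=> n; apply: le_trans (_ : 2^-1 * (\sum_(k < i + n) sqmod (alpha k)) + 2^-1 * psum x n <= _).
  apply: le_trans (_ : 2^-1 * (\sum_(j < n) sqmod (alpha (i + j)%N)) + 2^-1 * psum x n <= _).
    rewrite /psum !mulr_sumr -big_split; apply: ler_sum => j _ /=.
    rewrite (hnorm_scale hH); set s := Num.sqrt _; set t := hnorm _ _.
    have -> : sqmod (alpha (i + j)%N) = s ^+ 2 by rewrite sqr_sqrtr ?sqmod_ge0.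
    have : t ^+ 2 <= sqn (x j) by rewrite (hnorm_sqr hH) (car_le hH car).
    by have := sqr_ge0 (s - t); nra.
  rewrite lerD2r ler_pM2l ?invr_gt0 ?ltr0n //.
  exact: (sum_shift_le (f := fun k => sqmod (alpha k))) (fun k => sqmod_ge0 _).
by rewrite lerD // ler_pM2l ?invr_gt0 ?ltr0n.
Qed.

Lemma Gamma_lin (a : R[i]) x y : l2H x -> l2H y ->
  G (fun n => a *: x n + y n) = fun i => a *: G x i + G y i.
Proof.
move=> hx hy; apply/funext => i; apply: (limHE hH).
have := cvgHD hH (cvgHZ hH a (Gamma_cvg i hx)) (Gamma_cvg i hy).
apply: cvgH_near; exists 0%N => M _; rewrite scaler_sumr -big_split.
apply: eq_bigr => j _ /=; rewrite (carD car) (carZ car) scalerDr !scalerA.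
by rewrite [a * _]mulrC.
Qed.

(** The Hankel identity [Gamma S = S^* Gamma]: prepending a zero shifts the column index, and
    entries depend only on [i + j]. *)
Lemma Gamma_shift x i : l2H x -> G (shiftS x) i = G x i.+1.
Proof.
move=> hx; apply: (limHE hH); have := Gamma_cvg i.+1 hx => /(_ _ _) h e e0.
have [N hN] := h e e0; exists N.+1 => -[//|n] Nn.
rewrite big_ord_recl /= (car0 car) scaler0 add0r.
by under eq_bigr do rewrite /bump /= addnA addn1; exact: hN.
Qed.

Definition delta (n : nat) (h : H) : nat -> H := fun j => if j == n then h else 0.

Lemma Gamma_delta n h i : G (delta n h) i = alpha (i + n)%N *: C (i + n)%N h.
Proof.
apply: (limHE hH); apply: cvgH_near (cvgH_cst hH _); exists n.+1 => M nM.
rewrite (bigD1 (Ordinal nM)) //= /delta eqxx big1 ?addr0 // => j jn.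
by rewrite -val_eqE /= in jn; rewrite (negPf jn) (car0 car) scaler0.
Qed.

Lemma Gamma_bound : exists A : R, 0 <= A /\ forall x, l2H x ->
  forall N, psum (G x) N <= A * l2sq x.
Proof.
have [A hA] := alpha_l2; have A0 : 0 <= A by have := hA 0%N; rewrite big_ord0.
exists A; split=> // x hx N; rewrite /psum.
under eq_bigr do rewrite -[sqn _]mul1r.
apply: (cvgH_sum_le hH (w := fun=> 1) (l := G x)) => [i|M]; first exact: Gamma_cvg.
under eq_bigr do rewrite mul1r.
apply: le_trans (hankel_bound hH car alpha N M x) _.
rewrite ler_pM ?(psum_le hH) ?(psum_ge0 hH) ?hA //.
by apply: sumr_ge0 => k _; exact: sqmod_ge0.
Qed.

Lemma Gamma_weighted_bound (A : R) x :
  (forall n, \sum_(k < n) k.+1%:R ^+ 2 * sqmod (alpha k) <= A) -> l2H x ->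
  forall N, \sum_(i < N) i.+1%:R ^+ 2 * sqn (G x i) <= A * l2sq x.
Proof.
move=> hA hx N; have A0 : 0 <= A by have := hA 0%N; rewrite big_ord0.
apply: (cvgH_sum_le hH (w := fun i => i.+1%:R ^+ 2) (l := G x)) => [i|M].
  exact: Gamma_cvg.
apply: le_trans (weighted_hankel_bound hH car N M x hA) _.
by rewrite ler_wpM2l // (psum_le hH).
Qed.

Definition ksq p : R := l2sq p.1 + l2sq p.2.

Lemma ksq_ge0 p : inK p -> 0 <= ksq p.
Proof. by case=> h1 h2; rewrite addr_ge0 ?(l2sq_ge0 hH). Qed.

Lemma knorm_sqr p : inK p -> knorm p ^+ 2 = ksq p.
Proof. by move=> hp; rewrite sqr_sqrtr // ksq_ge0. Qed.

Lemma knorm_le (M : R) p q : 0 <= M -> ksq q <= M * ksq p ->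
  knorm q <= Num.sqrt M * knorm p.
Proof. by move=> M0 h; rewrite -sqrtrM //; exact: ler_wsqrtr. Qed.

Lemma l2sqD_le x y : l2H x -> l2H y ->
  l2sq (fun n => x n + y n) <= 2 * l2sq x + 2 * l2sq y.
Proof.
move=> hx hy; apply: (l2sq_le hH) => N.
apply: le_trans (_ : 2 * psum x N + 2 * psum y N <= _); last first.
  by rewrite lerD // ler_pM2l ?ltr0n // (psum_le hH).
by rewrite /psum !mulr_sumr -big_split; apply: ler_sum => n _; exact: sqnD_le.
Qed.

Lemma psum_shiftS x N : psum (shiftS x) N.+1 = psum x N.
Proof. by rewrite /psum big_ord_recl /= (sqn0 hH) add0r. Qed.

Lemma psum_shiftS_le x N : psum (shiftS x) N <= psum x N.
Proof. by rewrite -(psum_shiftS x) (psum_nd hH). Qed.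

Lemma psum_shiftSadj_le x N : psum (shiftSadj x) N <= psum x N.+1.
Proof. by rewrite /psum [leRHS]big_ord_recl lerDr (sqn_ge0 hH). Qed.

Lemma l2H_shiftS x : l2H x -> l2H (shiftS x).
Proof.
move=> hx; apply/(l2HP hH); exists (l2sq x) => N.
by apply: le_trans (psum_shiftS_le _ _) _; exact: psum_le.
Qed.

Lemma l2H_shiftSadj x : l2H x -> l2H (shiftSadj x).
Proof.
move=> hx; apply/(l2HP hH); exists (l2sq x) => N.
by apply: le_trans (psum_shiftSadj_le _ _) _; exact: psum_le.
Qed.

Lemma l2H_Gamma x : l2H x -> l2H (G x).
Proof.
have [A [_ hA]] := Gamma_bound; move=> hx; apply/(l2HP hH).
by exists (A * l2sq x); exact: hA.
Qed.

Lemma inK_RG p : inK p -> inK (RG G p).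
Proof.
case=> h1 h2; split; last exact: l2H_shiftS.
by apply: (l2HD hH); [exact: l2H_shiftSadj|exact: l2H_Gamma].
Qed.

Lemma RG_lin (a : R[i]) p q : inK p -> inK q ->
  RG G (kadd (kscale a p) q) = kadd (kscale a (RG G p)) (RG G q).
Proof.
move=> [p1 p2] [q1 q2]; rewrite /RG /kadd /kscale /= (Gamma_lin a p2 q2).
congr pair; apply/funext => n; last by case: n => //=; rewrite scaler0 addr0.
by rewrite /shiftSadj scalerDr addrACA.
Qed.

(** By the Hankel identity the corner of the [n]-th power is a sum of [n] equal terms, [Gamma]
    followed by [n - 1] backward shifts. At [n = 0] the truncated [n.-1] is harmless, since the
    factor [n%:R] vanishes. *)
Lemma iter_RG n h : iter n (RG G) (fun=> 0, delta 0 h)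
  = (fun i => (n%:R * alpha (i + n.-1)%N) *: C (i + n.-1)%N h, delta n h).
Proof.
elim: n => [|n IH] /=.
  by congr pair; apply/funext => i; rewrite mul0r scale0r.
rewrite IH /RG /=; congr pair; apply/funext => i; last by case: i.
rewrite Gamma_delta /shiftSadj.
case: n {IH} => [|n] /=; first by rewrite mul0r scale0r add0r mul1r.
by rewrite addSnnS -scalerDl -[n.+2%:R]natr1 mulrDl mul1r.
Qed.

Lemma iter_R0 n h : iter n (@R0 R H) (fun=> 0, delta 0 h) = (fun=> 0, delta n h).
Proof.
elim: n => [//|n IH] /=; rewrite IH /R0 /=.
by congr pair; apply/funext => -[].
Qed.

(** * Similarity under the weighted summability condition *)

Section Intertwiner.
Variable A : R.
Hypothesis hA : forall n, \sum_(k < n) k.+1%:R ^+ 2 * sqmod (alpha k) <= A.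

Let A0 : 0 <= A. Proof. by have := hA 0%N; rewrite big_ord0. Qed.

(* A solution of [S^* X - X S = Gamma]. *)
Definition intertwiner x : nat -> H :=
  fun n => if n is k.+1 then k.+1%:R *: G x k else 0.
Local Notation X := intertwiner.

Lemma psum_intertwiner x N : l2H x -> psum (X x) N <= A * l2sq x.
Proof.
move=> hx; apply: le_trans (psum_nd hH (X x) (leqnSn N)) _.
rewrite /psum big_ord_recl /= (sqn0 hH) add0r.
apply: le_trans (Gamma_weighted_bound hA hx N); rewrite le_eqVlt.
by apply/orP; left; apply/eqP; apply: eq_bigr => i _; rewrite (sqnZ hH) sqmod_nat.
Qed.

Lemma l2H_intertwiner x : l2H x -> l2H (X x).
Proof.
move=> hx; apply/(l2HP hH); exists (A * l2sq x) => N; exact: psum_intertwiner.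
Qed.

(** The block matrix [[[1, c X], [0, 1]]], with inverse [shear (- c)]. *)
Definition shear (c : R[i]) p : KH H := (fun n => p.1 n + c *: X p.2 n, p.2).

Lemma shear_bounded (c : R[i]) : bounded_opK ip (shear c).
Proof.
have hin p : inK p -> inK (shear c p).
  move=> [p1 p2]; split=> //=; apply: (l2HD hH) => //.
  by apply: (l2HZ hH); exact: l2H_intertwiner.
split=> //; split.
  move=> a p q [_ p2] [_ q2]; rewrite /shear /kadd /kscale /=; congr pair.
  apply/funext => n; rewrite scalerDr addrACA; congr (_ + _).
  case: n => [|n] /=; first by rewrite !scaler0 addr0.
  rewrite (Gamma_lin a p2 q2) !scalerDr !scalerA.
  by congr (_ *: _ + _); rewrite mulrC mulrA.
(* The first component contributes at most twice the squares of its two summands, the second one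
   contributes the last [1]. *)
exists (Num.sqrt (2 + 2 * (sqmod c * A) + 1)) => p [p1 p2].
have c0 := sqmod_ge0 c; have cA0 : 0 <= sqmod c * A by rewrite mulr_ge0.
apply: knorm_le; first by rewrite !addr_ge0 ?mulr_ge0.
rewrite /ksq /=.
have h := l2sqD_le p1 (l2HZ hH c (l2H_intertwiner p2)).
have hX : l2sq (fun n => c *: X p.2 n) <= sqmod c * A * l2sq p.2.
  apply: (l2sq_le hH) => N; rewrite -mulrA.
  apply: le_trans (ler_wpM2l c0 (psum_intertwiner N p2)); rewrite le_eqVlt.
  apply/orP; left; apply/eqP; rewrite /psum mulr_sumr.
  by apply: eq_bigr => i _; rewrite (sqnZ hH).
by have := l2sq_ge0 hH p1; have := l2sq_ge0 hH p2; nra.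
Qed.

Lemma shearK (c : R[i]) p : shear c (shear (- c) p) = p.
Proof.
case: p => x y; rewrite /shear /=; congr pair; apply/funext => n.
by rewrite scaleNr subrK.
Qed.

Lemma shear_RG p : inK p -> shear 1 (RG G (shear (-1) p)) = R0 p.
Proof.
move=> [p1 p2]; rewrite /shear /RG /R0 /=; congr pair; apply/funext => n.
(* In coordinate [n], the backward shift of [- X p.2] together with [Gamma p.2] leaves
   [- n (Gamma p.2) n]. The outer shear adds [n (Gamma (S p.2)) (n - 1) = n (Gamma p.2) n]; for
   [n = 0] both vanish. *)
rewrite /shiftSadj /= scaleN1r scale1r -natr1 scalerDl scale1r.
case: n => [|n] /=; first by rewrite scale0r add0r addr0 subrK.
by rewrite Gamma_shift // opprD addrA !subrK.
Qed.

Lemma weighted_similar : similar_to_contraction ip (RG G).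
Proof.
exists (shear 1), (shear (-1)); split; [exact: shear_bounded..| |].
  by move=> p _; rewrite shearK -{2}[1]opprK shearK.
move=> p hp; rewrite shear_RG //; apply: ler_wsqrtr; case: hp => p1 p2.
apply: lerD; apply: (l2sq_le hH) => N.
  by apply: le_trans (psum_shiftSadj_le _ _) _; exact: psum_le.
by apply: le_trans (psum_shiftS_le _ _) _; exact: psum_le.
Qed.

End Intertwiner.
End FoguelHankel.

(** * Quadratic nearness under the weighted summability condition *)

Section QuadNear.
Variables (R : realType) (H : lmodType R[i]) (ip : H -> H -> R[i]).
Hypothesis hH : is_hilbert ip.
Variables C Cs : nat -> H -> H.
Hypothesis car : car_family ip C Cs.
Variable alpha : nat -> R[i].
Hypothesis alpha_l2 : l2C alpha.
Local Notation sqn := (sqn ip).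
Local Notation l2sq := (l2sq ip).
Local Notation l2H := (l2H ip).
Local Notation psum := (psum ip).
Local Notation knorm := (knorm ip).
Local Notation inK := (inK ip).
Local Notation G := (Gamma ip alpha C).
Implicit Types (x y : nat -> H) (p q : KH H).

Lemma in_modHE p : in_modH p -> p = (fun=> 0, delta 0 (p.2 0%N)).
Proof.
case: p => x y [/= h1 h2]; congr pair; apply/funext => n; first exact: h1.
by rewrite /delta; case: n => [//|n]; rewrite h2.
Qed.

Lemma psum_delta n h N : psum (delta n h) N = if (n < N)%N then sqn h else 0.
Proof.
rewrite /psum; case: ifP => [nN|nN].
  rewrite (bigD1 (Ordinal nN)) //= /delta eqxx big1 ?addr0 // => j jn.
  by rewrite -val_eqE /= in jn; rewrite (negPf jn) (sqn0 hH).
rewrite big1 // => j _; rewrite /delta ifN ?(sqn0 hH) //.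
by apply: contraFN nN => /eqP <-.
Qed.

Lemma l2H_delta n h : l2H (delta n h).
Proof.
apply/(l2HP hH); exists (sqn h) => N; rewrite psum_delta.
by case: ifP => // _; exact: sqn_ge0.
Qed.

Lemma l2sq_delta n h : l2sq (delta n h) = sqn h.
Proof.
apply/eqP; rewrite eq_le; apply/andP; split.
  by apply: (l2sq_le hH) => N; rewrite psum_delta; case: ifP => // _; exact: sqn_ge0.
by have := sqn_le_l2sq hH n (l2H_delta n h); rewrite {1}/delta eqxx.
Qed.

Lemma l2sq0 : l2sq (fun=> 0) = 0.
Proof.
have -> : (fun=> 0) = delta 0 (0 : H) by apply/funext => n; rewrite /delta; case: ifP.
by rewrite l2sq_delta (sqn0 hH).
Qed.

Lemma inK_delta h : inK (fun=> 0, delta 0 h).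
Proof. by split; [exact: l2H0|exact: l2H_delta]. Qed.

Lemma knorm_delta h : knorm (fun=> 0, delta 0 h) ^+ 2 = sqn h.
Proof. by rewrite (knorm_sqr hH (inK_delta h)) /ksq /= l2sq0 add0r l2sq_delta. Qed.

(** Coordinate [i] of the sum in quadratic nearness, with [y n] the vector carried by the [n]-th
    argument. The term [n = 0] vanishes, so [j] stands for [n - 1] and the sum starts at [y 1]. *)
Definition row_sum (y : nat -> H) (N i : nat) : H :=
  \sum_(j < N) (j.+1%:R * alpha (i + j)%N) *: C (i + j)%N (y j.+1).

Lemma big_kadd_diff (N : nat) (x : nat -> KH H) :
  (forall n, (n <= N)%N -> in_modH (x n)) ->
  \big[@kadd R H/@k0 R H]_(n < N.+1)
      ksub (iter n (RG G) (x n)) (iter n (@R0 R H) (x n))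
    = (row_sum (fun n => (x n).2 0%N) N, fun=> 0).
Proof.
move=> hx; pose F (n : nat) := ksub (iter n (RG G) (x n)) (iter n (@R0 R H) (x n)).
rewrite [LHS](_ : _ = \big[@kadd R H/@k0 R H]_(n < N.+1) F n) //.
have proj1 i : (\big[@kadd R H/@k0 R H]_(n < N.+1) F n).1 i = \sum_(n < N.+1) (F n).1 i.
  exact: (big_morph (fun p : KH H => p.1 i)).
have proj2 i : (\big[@kadd R H/@k0 R H]_(n < N.+1) F n).2 i = \sum_(n < N.+1) (F n).2 i.
  exact: (big_morph (fun p : KH H => p.2 i)).
have FE n : (n <= N)%N ->
    F n = (fun i => (n%:R * alpha (i + n.-1)%N) *: C (i + n.-1)%N ((x n).2 0%N), fun=> 0).
  move=> nN; rewrite /F (in_modHE (hx n nN)) (iter_RG hH car) iter_R0 /ksub /=.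
  by congr pair; apply/funext => i; rewrite ?subr0 ?subrr.
clearbody F; rewrite [LHS]surjective_pairing; congr pair; apply/funext => i.
  rewrite proj1 big_ord_recl FE //= mul0r scale0r add0r.
  by apply: eq_bigr => j _; rewrite FE //= /bump /= add1n //.
by rewrite proj2 big1 // => n _; rewrite FE // -ltnS.
Qed.

Lemma l2H_row_sum y N : l2H (row_sum y N).
Proof.
rewrite /row_sum; elim: N => [|N IH].
  by have -> : (fun i => \sum_(j < 0) (j.+1%:R * alpha (i + j)%N) *: C (i + j)%N (y j.+1))
    = fun=> 0; [apply/funext => i; rewrite big_ord0|exact: l2H0].
(* Each added column is square summable because [alpha] is and [C] is contractive. *)
pose z i := alpha (i + N)%N *: C (i + N)%N (y N.+1).
have hz : l2H z.
  have [A hA] := alpha_l2; apply/(l2HP hH); exists (A * sqn (y N.+1)) => n.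
  apply: le_trans (_ : (\sum_(k < N + n) sqmod (alpha k)) * sqn (y N.+1) <= _); last first.
    by rewrite ler_wpM2r ?(sqn_ge0 hH) // hA.
  apply: le_trans (_ : (\sum_(j < n) sqmod (alpha (N + j)%N)) * sqn (y N.+1) <= _); last first.
    rewrite ler_wpM2r ?(sqn_ge0 hH) //.
    exact: (sum_shift_le (f := fun k => sqmod (alpha k))) (fun k => sqmod_ge0 _).
  rewrite mulr_suml; apply: ler_sum => i _; rewrite /z (sqnZ hH) addnC.
  by rewrite ler_wpM2l ?sqmod_ge0 // (car_le hH car).
have := l2H_lin hH N.+1%:R hz IH; congr (Defs.l2H ip _); apply/funext => i.
by rewrite big_ord_recr /= addrC scalerA.
Qed.

Lemma weighted_quad_near (A : R) :
  (forall n, \sum_(k < n) k.+1%:R ^+ 2 * sqmod (alpha k) <= A) ->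
  quad_near_modH ip (RG G).
Proof.
move=> hA; have A0 : 0 <= A by have := hA 0%N; rewrite big_ord0.
exists (Num.sqrt (4 * A)) => N x hx; rewrite big_kadd_diff //.
rewrite -sqrtrM ?mulr_ge0 //; apply: ler_wsqrtr; rewrite /= l2sq0 addr0.
set y := fun n => (x n).2 0%N.
have -> : \sum_(n < N.+1) knorm (x n) ^+ 2 = \sum_(n < N.+1) sqn (y n).
  apply: eq_bigr => n _; have nN : (n <= N)%N by rewrite -ltnS.
  by rewrite {1}(in_modHE (hx n nN)) knorm_delta.
set Y := \sum_(n < N.+1) sqn (y n).
have YS : \sum_(j < N) sqn (y j.+1) <= Y.
  by rewrite /Y big_ord_recl lerDr (sqn_ge0 hH).
apply: (l2sq_le hH) => M.
(* As [j + 1 = (i + j + 1) - i], each row is a Hankel row of symbol [c] minus [i] times one of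
   symbol [alpha]. The constant [4 * A] comes from [2 * S1 + 2 * S2], where each sum is at most
   [A * Y]. *)
pose c (k : nat) := k.+1%:R * alpha k.
have h1 := hankel_bound hH car c M N (fun j => y j.+1).
have h2 := weighted_hankel_bound hH car M N (fun j => y j.+1) hA.
set S1 := \sum_(i < M) _ in h1; set S2 := \sum_(i < M) _ in h2.
have hc : \sum_(k < M + N) sqmod (c k) <= A.
  apply: le_trans (hA (M + N)%N); rewrite le_eqVlt; apply/orP; left; apply/eqP.
  by apply: eq_bigr => k _; rewrite /c sqmodM sqmod_nat.
have hS1 : S1 <= A * Y.
  apply: le_trans h1 _; rewrite ler_pM ?sumr_ge0 // => k _; first exact: sqmod_ge0.
  exact: sqn_ge0.
have hS2 : S2 <= A * Y by apply: le_trans h2 _; rewrite ler_wpM2l.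
apply: le_trans (_ : 2 * S1 + 2 * S2 <= _); last by lra.
rewrite /S1 /S2 !mulr_sumr -big_split; apply: ler_sum => i _ /=.
set u := \sum_(j < N) c _ *: _; set v := \sum_(j < N) _.
have -> : row_sum y N i = u - i%:R *: v.
  rewrite /u /v scaler_sumr -sumrB; apply: eq_bigr => j _.
  rewrite scalerA -scalerBl -mulrBl; congr (_ * _ *: _).
  by rewrite -addnS natrD addrC addKr.
apply: le_trans (sqnD_le hH _ _) _; rewrite lerD2l ler_pM2l ?ltr0n //.
rewrite (sqnN hH) (sqnZ hH) sqmod_nat ler_wpM2r ?(sqn_ge0 hH) //.
by rewrite ler_sqr ?nnegrE ?ler0n // ler_nat.
Qed.

End QuadNear.

(** * Clifford matrices as signed permutations *)

Section Clifford.

(* Signed involutions [x |-> (-1)^(eps n t) x (pi n t)] that pairwise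
   anticommute: self-adjoint unitary matrices satisfying the Clifford relations. *)
Definition clifford_action (N : nat) (I : finType) (pi : nat -> I -> I)
    (eps : nat -> I -> bool) : Prop :=
  [/\ forall n t, (n < N)%N -> pi n (pi n t) = t,
      forall n t, (n < N)%N -> eps n (pi n t) = eps n t,
      forall n m t, (n < N)%N -> (m < N)%N -> pi n (pi m t) = pi m (pi n t) &
      forall n m t, (n < N)%N -> (m < N)%N -> n != m ->
        eps n t (+) eps m (pi n t) = ~~ (eps m t (+) eps n (pi m t))].

Variables (R : realType) (H : lmodType R[i]) (ip : H -> H -> R[i]).
Hypothesis hH : is_hilbert ip.
Variables C Cs : nat -> H -> H.
Hypothesis car : car_family ip C Cs.
Local Notation rip := (rip ip).
Local Notation sqn := (sqn ip).

Definition clifford_gen n (x : H) : H := C n x + Cs n x.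
Local Notation g := clifford_gen.

Lemma clifford_genN n x : g n (- x) = - g n x.
Proof. by rewrite /g (carN car) (carsN hH car) opprD. Qed.

Lemma clifford_gen_sq n x : g n (g n x) = x.
Proof.
rewrite /g (carD car) (carsD hH car) (car_sq car) add0r (cars_sq hH car) addr0.
by rewrite (car_mix car) eqxx scale1r subrK.
Qed.

Lemma clifford_gen_anti n m x : n != m -> g n (g m x) = - g m (g n x).
Proof.
move=> nm; rewrite /g !(carD car) !(carsD hH car).
rewrite (car_anti car n m) (cars_anti hH car n m).
rewrite !(car_mix car) [m == n]eq_sym (negPf nm) !scale0r !sub0r.
by rewrite addrACA !opprD !opprK.
Qed.

(** Read [h] as a vector in the tensor product of [H] with the functions on [I]: on it, the signed
    permutation matrix [D_n] acts as [g n] does. *)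
Lemma clifford_model (x0 : H) (N : nat) : x0 <> 0 ->
  exists (I : finType) (pi : nat -> I -> I) (eps : nat -> I -> bool) (h : I -> H),
    [/\ clifford_action N pi eps,
        forall n t, (n < N)%N -> (-1) ^+ eps n t *: h (pi n t) = g n (h t) &
        0 < \sum_t sqn (h t)].
Proof.
move=> x0n; elim: N => [|N [I [pi [eps [h [[piK epsK piC epsC] hg h_gt0]]]]]].
  exists unit, (fun _ t => t), (fun _ _ => false), (fun=> x0); split => //.
  rewrite big_const card_unit /= addr0 lt_neqAle (sqn_ge0 hH) andbT eq_sym.
  by apply/eqP => /(sqn_eq0 hH).
(* The index set is doubled. The new generator swaps the two copies, the old ones change sign on the
   second copy, and that copy stores [g N (h t)]; the signs match because [g n] and [g N]
   anticommute. *)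
exists (I * bool)%type.
exists (fun n t => if n == N then (t.1, ~~ t.2) else (pi n t.1, t.2)).
exists (fun n t => if n == N then false else eps n t.1 (+) t.2).
exists (fun t => if t.2 then g N (h t.1) else h t.1).
have lt_N n : (n < N.+1)%N -> n != N -> (n < N)%N by lia.
split.
- split.
  + move=> n [t c] nN /=; case: (eqVneq n N) => [_|nn] /=; first by rewrite negbK.
    by rewrite piK ?lt_N.
  + by move=> n [t c] nN; case: (eqVneq n N) => //= nn; rewrite epsK ?lt_N.
  + move=> n m [t c] nN mN; case: (eqVneq n N) => [_|nn]; case: (eqVneq m N) => [_|mn] //=.
    by rewrite piC ?lt_N.
  + move=> n m [t c] nN mN nm.
    case: (eqVneq n N) => [nE|nn]; case: (eqVneq m N) => [mE|mn] //=.
    * by rewrite nE mE eqxx in nm.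
    * by case: (eps m t); case: c.
    * by case: (eps n t); case: c.
    * have := epsC n m t (lt_N n nN nn) (lt_N m mN mn) nm.
      move: (eps n t) (eps m t) (eps n (pi m t)) (eps m (pi n t)) => e1 e2 e3 e4.
      by case: e1; case: e2; case: e3; case: e4; case: c.
- move=> n [t c] nN; case: (eqVneq n N) => [->|nn] /=.
    by rewrite expr0 scale1r; case: c => //=; rewrite clifford_gen_sq.
  case: c; last by rewrite addbF hg ?lt_N.
  rewrite clifford_gen_anti // -(hg n t) ?lt_N // addbT.
  by case: (eps n t); rewrite /= ?expr0 ?expr1 ?scale1r ?scaleN1r ?clifford_genN ?opprK.
- apply: lt_le_trans h_gt0 _.
  rewrite -(pair_big xpredT xpredT (fun t c => sqn (if c then g N (h t) else h t))) /=.
  by apply: ler_sum => t _; rewrite big_bool /= lerDr (sqn_ge0 hH).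
Qed.

(** * Lower bound from a vector on which [D_n] acts as [g n] *)

Section LowerBound.
Variables (N : nat) (I : finType) (pi : nat -> I -> I) (eps : nat -> I -> bool).
Variable h : I -> H.
Hypothesis hpi : clifford_action N pi eps.
Hypothesis hg : forall n t, (n < N)%N -> (-1) ^+ eps n t *: h (pi n t) = g n (h t).
Hypothesis h_gt0 : 0 < \sum_t sqn (h t).

Lemma clifford_action_inj n : (n < N)%N -> injective (pi n).
Proof.
by case: hpi => piK _ _ _ nN t u tu; rewrite -(piK n t nN) tu piK.
Qed.

(** Replacing [h] by [g n h] only permutes its entries and changes signs, and
    [Cs n (g n x) = Cs n (C n x)] has the norm of [C n x]. So the two terms of [car_sqn] have equal
    sums over [t]. *)
Lemma sum_sqn_cars n : (n < N)%N ->
  \sum_t sqn (Cs n (h t)) = 2^-1 * \sum_t sqn (h t).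
Proof.
move=> nN; have E : \sum_t sqn (Cs n (h t)) = \sum_t sqn (C n (h t)).
  rewrite (reindex_inj (clifford_action_inj nN)); apply: eq_bigr => t _ /=.
  have -> : sqn (Cs n (h (pi n t))) = sqn (Cs n (g n (h t))).
    by rewrite -hg // (carsZ hH car) (sqnZ hH) sqmod_sign mul1r.
  rewrite (carsD hH car) (cars_sq hH car) addr0 /sqn -(car_rip car) (car_mix car) eqxx.
  by rewrite scale1r (car_sq car) (cars0 hH car) subr0.
have : \sum_t sqn (h t) = \sum_t sqn (C n (h t)) + \sum_t sqn (Cs n (h t)).
  by rewrite -big_split; apply: eq_bigr => t _ /=; rewrite (car_sqn hH car).
by move=> ->; rewrite -E; field.
Qed.

Lemma clifford_lower_bound (b : nat -> R[i]) (K : R) :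
  \sum_t sqn (\sum_(k < N) (b k * conjc (b k)) *: C k (g k (h t)))
    <= K * (\sum_(k < N) sqmod (b k)) * \sum_t sqn (h t) -> 0 <= K ->
  \sum_(k < N) sqmod (b k) <= 4 * K.
Proof.
set B := \sum_(k < N) sqmod (b k) => hK K0.
pose v t := \sum_(k < N) (b k * conjc (b k)) *: C k (g k (h t)).
have {}hK : \sum_t sqn (v t) <= K * B * \sum_t sqn (h t) by [].
have B0 : 0 <= B by apply: sumr_ge0 => k _; exact: sqmod_ge0.
(* [C k (g k x) = C k (Cs k x)], and its form at [x] is [sqn (Cs k x)]. *)
have vh : \sum_t rip (v t) (h t) = B * (2^-1 * \sum_t sqn (h t)).
  rewrite /v; under eq_bigr do rewrite (rip_suml hH).
  rewrite exchange_big mulr_suml; apply: eq_bigr => k _ /=.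
  rewrite -(sum_sqn_cars (ltn_ord k)) mulr_sumr; apply: eq_bigr => t _.
  by rewrite mul_conjc (ripRZ hH) (carD car) (car_sq car) add0r (car_rip car).
(* Cauchy-Schwarz for [v] and [h] in expanded form: by [vh], [B / 2] is the coefficient of the
   projection of [v] on [h]. *)
have : 0 <= \sum_t sqn (v t - (B / 2)%:C%C *: h t).
  by apply: sumr_ge0 => t _; exact: sqn_ge0.
have -> : \sum_t sqn (v t - (B / 2)%:C%C *: h t)
    = \sum_t sqn (v t) - B * \sum_t rip (v t) (h t) + B ^+ 2 / 4 * \sum_t sqn (h t).
  rewrite !mulr_sumr -sumrB -big_split; apply: eq_bigr => t _ /=.
  by rewrite (sqnB hH) (ripRZr hH) /sqn (ripRZ hH) (ripRZr hH); field.
rewrite vh; have [Bp|] := ltP 0 B; last by move: h_gt0; nra.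
move=> h1; have : 0 <= (K - B / 4) * (B * \sum_t sqn (h t)) by lra.
by rewrite pmulr_lge0 ?mulr_gt0 //; lra.
Qed.

End LowerBound.
End Clifford.

(** * Toeplitz positivity of a contraction for a semi-definite form on a subspace [P] *)

Section Contraction.
Variables (R : realType) (V : lmodType R[i]) (P : V -> Prop) (rho : V -> V -> R).
Hypothesis P0 : P 0.
Hypothesis P_lin : forall (a : R[i]) x y, P x -> P y -> P (a *: x + y).
Hypothesis rhoDl : forall x y z, P x -> P y -> P z ->
  rho (x + y) z = rho x z + rho y z.
Hypothesis rhoC : forall x y, rho x y = rho y x.
Hypothesis rhoZ : forall (a : R[i]) x y, rho (a *: x) y = rho x (conjc a *: y).
Hypothesis rho_real : forall (r : R) x y, P x -> P y ->
  rho (r%:C%C *: x) y = r * rho x y.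
Hypothesis rho_ge0 : forall x, P x -> 0 <= rho x x.

Let PD x y : P x -> P y -> P (x + y).
Proof. by move=> hx hy; rewrite -[x]scale1r; exact: P_lin. Qed.

Let PZ (a : R[i]) x : P x -> P (a *: x).
Proof. by move=> hx; rewrite -[_ *: _]addr0; exact: P_lin. Qed.

Let P_sum (I : Type) (s : seq I) (Q : pred I) (F : I -> V) :
  (forall i, P (F i)) -> P (\sum_(i <- s | Q i) F i).
Proof. by move=> hF; elim/big_rec: _ => // i x _; exact: PD. Qed.

Let rho0l y : P y -> rho 0 y = 0.
Proof. by move=> hy; apply: (addrI (rho 0 y)); rewrite -rhoDl ?addr0. Qed.

Let rhoNl x y : P x -> P y -> rho (- x) y = - rho x y.
Proof.
move=> hx hy; apply/eqP; rewrite -addr_eq0 -rhoDl // ?addNr ?rho0l //.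
by rewrite -scaleN1r; exact: PZ.
Qed.

Let rho_sign (c : bool) x y : P x -> P y -> rho ((-1) ^+ c *: x) y = (-1) ^+ c * rho x y.
Proof.
by move=> hx hy; case: c; rewrite ?expr1 ?expr0 ?scaleN1r ?scale1r ?rhoNl ?mulN1r ?mul1r.
Qed.

Let rho_suml (I : Type) (s : seq I) (Q : pred I) (F : I -> V) y :
  (forall i, P (F i)) -> P y ->
  rho (\sum_(i <- s | Q i) F i) y = \sum_(i <- s | Q i) rho (F i) y.
Proof.
move=> hF hy.
suff : P (\sum_(i <- s | Q i) F i) /\
    rho (\sum_(i <- s | Q i) F i) y = \sum_(i <- s | Q i) rho (F i) y by case.
elim/big_rec2: _ => [|i u v _ [hv <-]]; first by rewrite rho0l.
by split; [exact: PD|rewrite rhoDl].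
Qed.

Variable T : V -> V.
Hypothesis P_T : forall x, P x -> P (T x).
Hypothesis T_lin : forall (a : R[i]) x y, P x -> P y -> T (a *: x + y) = a *: T x + T y.
Hypothesis T_contr : forall x, P x -> rho (T x) (T x) <= rho x x.

Let P_iter n x : P x -> P (iter n T x).
Proof. by move=> hx; elim: n => //= n; exact: P_T. Qed.

Let TD x y : P x -> P y -> T (x + y) = T x + T y.
Proof. by move=> hx hy; rewrite -[x in LHS]scale1r T_lin // scale1r. Qed.

Let T0 : T 0 = 0.
Proof. by apply: (addrI (T 0)); rewrite -TD ?addr0. Qed.

Let TZ (a : R[i]) x : P x -> T (a *: x) = a *: T x.
Proof. by move=> hx; rewrite -[a *: x]addr0 T_lin // T0 addr0. Qed.

Let T_sum (I : Type) (s : seq I) (Q : pred I) (F : I -> V) :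
  (forall i, P (F i)) ->
  T (\sum_(i <- s | Q i) F i) = \sum_(i <- s | Q i) T (F i).
Proof.
move=> hF.
suff : P (\sum_(i <- s | Q i) F i) /\
    T (\sum_(i <- s | Q i) F i) = \sum_(i <- s | Q i) T (F i) by case.
elim/big_rec2: _ => [|i u v _ [hv <-]]; first by rewrite T0.
by split; [exact: PD|rewrite TD].
Qed.

Let iterZ n (a : R[i]) x : P x -> iter n T (a *: x) = a *: iter n T x.
Proof. by move=> hx; elim: n => //= n ->; rewrite TZ //; exact: P_iter. Qed.

(** The kernel has entry [T^(n - m)] for [m < n] and the adjoint entry for [m > n]; in the real form
    the two merge into the factor 2. *)
Definition toeplitz_form (N : nat) (y : nat -> V) : R :=
  \sum_(n < N) rho (y n) (y n)
  + 2 * \sum_(n < N) \sum_(m < N | (m < n)%N) rho (iter (n - m) T (y n)) (y m).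

(* Positivity of the Toeplitz kernel [T^n, T*^n] of a contraction, in the form
   that the unitary dilation would give. *)
Lemma toeplitz_positive (N : nat) (y : nat -> V) : (forall n, P (y n)) ->
  rho (\sum_(n < N) iter n T (y n)) (\sum_(n < N) iter n T (y n))
    <= toeplitz_form N y.
Proof.
rewrite /toeplitz_form; elim: N y => [|N IH] y hy.
  by rewrite !big_ord0 rho0l // mulr0 addr0.
(* Horner scheme: the sum is [y 0 + T Z]. Contractivity removes [T] from the square of [T Z], the
   induction hypothesis bounds that of [Z], and the cross term with [y 0] is the column [m = 0] of
   the form. *)
have := IH (fun n => y n.+1) (fun n => hy n.+1).
set Z := \sum_(n < N) iter n T (y n.+1) => hZ.
have PZZ : P Z by apply: P_sum => n; exact: P_iter.
have -> : \sum_(n < N.+1) iter n T (y n) = y 0%N + T Z.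
  rewrite big_ord_recl /=; congr (_ + _); rewrite /Z T_sum //.
  by move=> n; exact: P_iter.
have -> : rho (y 0%N + T Z) (y 0%N + T Z)
    = rho (y 0%N) (y 0%N) + 2 * rho (T Z) (y 0%N) + rho (T Z) (T Z).
  have hTZ := P_T PZZ; have h0 := hy 0%N.
  rewrite rhoDl ?[rho _ (_ + _)]rhoC //; try exact: PD.
  by rewrite !rhoDl // (rhoC (y 0%N) (T Z)); ring.
have -> : \sum_(n < N.+1) \sum_(m < N.+1 | (m < n)%N) rho (iter (n - m) T (y n)) (y m)
    = rho (T Z) (y 0%N) + \sum_(n < N) \sum_(m < N | (m < n)%N)
        rho (iter (n - m) T (y n.+1)) (y m.+1).
  rewrite big_ord_recl big1 ?add0r // /Z T_sum; last by move=> n; exact: P_iter.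
  rewrite rho_suml //; last by move=> n; exact/P_T/P_iter.
  rewrite -big_split; apply: eq_bigr => n _ /=.
  by rewrite big_mkcond big_ord_recl /= -big_mkcond.
rewrite [X in _ <= X + _]big_ord_recl /=.
by have := le_trans (T_contr PZZ) hZ; rewrite /bump /=; lra.
Qed.

(** * Cancellation of the off-diagonal terms for Clifford coefficients *)

Section CliffordCoefficients.
Variables (N : nat) (I : finType) (pi : nat -> I -> I) (eps : nat -> I -> bool).
Hypothesis hpi : clifford_action N pi eps.
Variables (b : nat -> R[i]) (x : I -> V).
Hypothesis Px : forall t, P (x t).

Let D n t := (-1) ^+ eps n t *: x (pi n t).

Let P_D n t : P (D n t). Proof. exact: PZ. Qed.

Let pairing n m k (a c : R[i]) t : rho (iter k T (a *: D n t)) (c *: D m t)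
  = (-1) ^+ (eps n t (+) eps m t) *
    rho ((a * conjc c) *: iter k T (x (pi n t))) (x (pi m t)).
Proof.
have PX := PZ (a * conjc c) (P_iter k (Px (pi n t))).
have -> : rho (iter k T (a *: D n t)) (c *: D m t)
    = rho ((-1) ^+ eps n t *: ((a * conjc c) *: iter k T (x (pi n t)))) (D m t).
  rewrite rhoC [LHS]rhoZ rhoC; congr (rho _ _).
  rewrite /D !iterZ //; last exact: PZ.
  by rewrite !scalerA; congr (_ *: _); ring.
by rewrite rho_sign // [rho _ (D m t)]rhoC rho_sign // mulrA -signr_addb rhoC.
Qed.

(** [D_n] is self-adjoint, commutes with [T] and anticommutes with [D_m], so exchanging [n] and [m]
    costs a sign; the conjugated coefficients give the same scalar [b n * conjc (b m)]. Reindexing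
    by [pi n (pi m t)] performs the exchange. *)
Let off_diagonal n m k : (n < N)%N -> (m < N)%N -> n != m ->
  \sum_t rho (iter k T (conjc (b m) *: D m t)) (conjc (b n) *: D n t)
  = - \sum_t rho (iter k T (b n *: D n t)) (b m *: D m t).
Proof.
case: hpi => piK epsK piC epsC nN mN nm.
have inj : injective (fun t => pi n (pi m t)).
  by move=> t u /(congr1 (pi n)); rewrite !piK // => /(congr1 (pi m)); rewrite !piK.
rewrite (reindex_inj inj) -sumrN; apply: eq_bigr => t _ /=.
have mnm : pi m (pi n (pi m t)) = pi n t by rewrite (piC n m) // piK.
have nnm : pi n (pi n (pi m t)) = pi m t by rewrite piK.
rewrite !pairing mnm nnm conjcK [conjc _ * _]mulrC -mulNr; congr (_ * _).
rewrite -signrN; congr (_ ^+ nat_of_bool _).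
rewrite epsK // (piC n m) // epsK //; have := epsC n m t nN mN nm.
move: (eps n t) (eps m t) (eps n (pi m t)) (eps m (pi n t)) => e1 e2 e3 e4.
by case: e1; case: e2; case: e3; case: e4.
Qed.

Let diagonal n (a : R[i]) : (n < N)%N ->
  \sum_t rho (a *: D n t) (a *: D n t) = sqmod a * \sum_t rho (x t) (x t).
Proof.
case: hpi => piK _ _ _ nN.
have inj : injective (pi n) by move=> t u tu; rewrite -(piK n t nN) tu piK.
rewrite (reindex_inj inj) mulr_sumr; apply: eq_bigr => t _ /=.
by rewrite (pairing n n 0) addbb expr0 mul1r /= mul_conjc rho_real // piK.
Qed.

Let sum_toeplitz (y : I -> nat -> V) : \sum_t toeplitz_form N (y t)
  = \sum_(n < N) \sum_t rho (y t n) (y t n)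
    + 2 * \sum_(n < N) \sum_(m < N | (m < n)%N)
        \sum_t rho (iter (n - m) T (y t n)) (y t m).
Proof.
rewrite /toeplitz_form big_split /= -mulr_sumr exchange_big; congr (_ + 2 * _).
by rewrite exchange_big; apply: eq_bigr => n _; rewrite exchange_big.
Qed.

Lemma contraction_clifford_bound :
  \sum_t rho (\sum_(n < N) iter n T (b n *: D n t)) (\sum_(n < N) iter n T (b n *: D n t))
    <= 2 * (\sum_(n < N) sqmod (b n)) * \sum_t rho (x t) (x t).
Proof.
pose y t n := b n *: D n t.
(* The reversed sequence with conjugated coefficients has the same diagonal sum, and its cross terms
   carry the same powers of [T] with opposite sign. Its form is nonnegative, so it may be added to
   that of [y]. *)
pose y' t n := conjc (b (N - n.+1)%N) *: D (N - n.+1)%N t.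
suff E : \sum_t toeplitz_form N (y t) + \sum_t toeplitz_form N (y' t)
    = 2 * (\sum_(n < N) sqmod (b n)) * \sum_t rho (x t) (x t).
  rewrite -E; apply: ler_wpDr; last first.
    by apply: ler_sum => t _; apply: toeplitz_positive => n; exact: PZ.
  apply: sumr_ge0 => t _; apply: le_trans (toeplitz_positive _ _).
    by apply/rho_ge0/P_sum => n; apply/P_iter/PZ.
  by move=> n; exact: PZ.
have revK (n : 'I_N) : (N - (N - n.+1).+1)%N = n by have := ltn_ord n; lia.
rewrite !sum_toeplitz addrACA -mulrDr.
have -> : \sum_(n < N) \sum_t rho (y t n) (y t n)
    = (\sum_(n < N) sqmod (b n)) * \sum_t rho (x t) (x t).
  by rewrite mulr_suml; apply: eq_bigr => n _; rewrite diagonal.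
have -> : \sum_(n < N) \sum_t rho (y' t n) (y' t n)
    = (\sum_(n < N) sqmod (b n)) * \sum_t rho (x t) (x t).
  rewrite (reindex_inj rev_ord_inj) mulr_suml; apply: eq_bigr => n _ /=.
  by rewrite /y' revK diagonal // sqmod_conj.
rewrite [X in _ + 2 * X](_ : _ = 0) ?mulr0 ?addr0; last first.
  rewrite [X in _ + X](reindex_inj rev_ord_inj) /=.
  under [X in _ + X]eq_bigr => n _ do rewrite (reindex_inj rev_ord_inj) /=.
  rewrite [X in _ + X](exchange_big_dep xpredT) //= -big_split big1 // => n _ /=.
  rewrite [X in _ + X](eq_bigl (fun m : 'I_N => (m < n)%N)); last first.
    by move=> m; have := ltn_ord n; have := ltn_ord m; lia.
  rewrite -big_split big1 // => m mn /=; rewrite /y' !revK.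
  have -> : (N - m.+1 - (N - n.+1) = n - m)%N by have := ltn_ord n; lia.
  by rewrite off_diagonal ?subrr // neq_ltn mn orbT.
by rewrite -mulr2n mulr_natl mulrnAl.
Qed.
End CliffordCoefficients.
End Contraction.

(** * Necessity of the weighted summability condition *)

Section Equivalence.
Variables (R : realType) (H : lmodType R[i]) (ip : H -> H -> R[i]).
Hypothesis hH : is_hilbert ip.
Variables C Cs : nat -> H -> H.
Hypothesis car : car_family ip C Cs.
Variable alpha : nat -> R[i].
Hypothesis alpha_l2 : l2C alpha.
Variable x0 : H.
Hypothesis x0_neq0 : x0 <> 0.
Local Notation sqn := (sqn ip).
Local Notation knorm := (knorm ip).
Local Notation ksq := (ksq ip).
Local Notation inK := (inK ip).
Local Notation G := (Gamma ip alpha C).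
Local Notation g := (clifford_gen C Cs).

(** Its operations are [kadd] and [kscale] up to conversion, so the abstract contraction bound
    applies with [inK] as the subspace. *)
Let V : lmodType R[i] := ((nat -> H) * (nat -> H))%type.

Let sqr_le (a s b : R) : 0 <= a -> a <= s * b -> a ^+ 2 <= s ^+ 2 * b ^+ 2.
Proof. by move=> a0 ab; rewrite -exprMn; apply: lerXn2r => //; rewrite nnegrE (le_trans a0). Qed.

Lemma sqn_clifford_gen n (x : H) : sqn (g n x) = sqn x.
Proof.
rewrite /clifford_gen (sqnD hH) -(car_rip car) (car_sq car) (rip0l hH) mulr0 addr0.
exact: car_sqn.
Qed.

(** Coefficient of [C k] in coordinate 0 of the corner of the power [k + 1] of [RG G]. *)
Let beta k : R[i] := k.+1%:R * alpha k.

Let sum_beta N : \sum_(k < N) sqmod (beta k)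
  = \sum_(k < N) k.+1%:R ^+ 2 * sqmod (alpha k).
Proof. by apply: eq_bigr => k _; rewrite /beta sqmodM sqmod_nat. Qed.

Lemma quad_near_weighted : quad_near_modH ip (RG G) ->
  exists A : R, forall N, \sum_(k < N) k.+1%:R ^+ 2 * sqmod (alpha k) <= A.
Proof.
move=> [s hs]; exists (4 * s ^+ 2) => N; rewrite -sum_beta.
have [I [pi [eps [h [hpi hg h_gt0]]]]] := clifford_model hH car N x0_neq0.
apply: (clifford_lower_bound hH car hpi hg h_gt0); last exact: sqr_ge0.
rewrite mulr_sumr; apply: ler_sum => t _.
(* These test vectors turn coordinate 0 of the sum into the vector of [clifford_lower_bound], and
   [sqn (y k.+1) = sqmod (beta k) * sqn (h t)] because [g k] is isometric. The value [y 0 = 0]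
   belongs to the vanishing term [n = 0]. *)
pose y n := if n is k.+1 then conjc (beta k) *: g k (h t) else 0.
pose x n : KH H := (fun=> 0, delta 0 (y n)).
have hx n : (n <= N)%N -> in_modH (x n) by move=> _; split=> // -[].
have := hs N x hx; rewrite (big_kadd_diff hH car) //.
have l2r := l2H_row_sum hH car alpha_l2 y N.
have -> : (fun n => (x n).2 0%N) = y by apply/funext => n.
have inr : inK (row_sum C alpha y N, fun=> 0) by split => //; exact: l2H0.
have X0 : 0 <= \sum_(n < N.+1) knorm (x n) ^+ 2 by apply: sumr_ge0 => n _; exact: sqr_ge0.
move=> /(sqr_le (sqrtr_ge0 _)); rewrite (knorm_sqr hH inr) sqr_sqrtr //.
rewrite /ksq /= (l2sq0 hH) addr0 => hrow.
have -> : \sum_(k < N) (beta k * conjc (beta k)) *: C k (g k (h t)) = row_sum C alpha y N 0.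
  by apply: eq_bigr => k _; rewrite (carZ car) scalerA.
apply: le_trans (sqn_le_l2sq hH 0 l2r) _; apply: le_trans hrow _.
rewrite -mulrA ler_wpM2l ?sqr_ge0 // mulr_suml big_ord_recl (knorm_delta hH) (sqn0 hH) add0r.
apply: ler_sum => k _; rewrite (knorm_delta hH) /= (sqnZ hH) sqmod_conj.
by rewrite sqn_clifford_gen.
Qed.

Definition kip (p q : V) : R := srip ip p.1 q.1 + srip ip p.2 q.2.

Let inK0 : inK (0 : V). Proof. by split; exact: l2H0. Qed.

Let inK_lin (a : R[i]) (p q : V) : inK p -> inK q -> inK (a *: p + q).
Proof. by move=> [p1 p2] [q1 q2]; split; apply: (l2H_lin hH). Qed.

Let kipDl (p q r : V) : inK p -> inK q -> inK r -> kip (p + q) r = kip p r + kip q r.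
Proof.
move=> [p1 p2] [q1 q2] [r1 r2]; rewrite /kip addrACA.
by rewrite -!(sripDl hH).
Qed.

Let kipC (p q : V) : kip p q = kip q p.
Proof. by rewrite /kip (sripC hH p.1) (sripC hH p.2). Qed.

Let kipZ (a : R[i]) (p q : V) : kip (a *: p) q = kip p (conjc a *: q).
Proof. by rewrite /kip; congr (_ + _); exact: sripZ. Qed.

Let kip_real (r : R) (p q : V) : inK p -> inK q -> kip (r%:C%C *: p) q = r * kip p q.
Proof.
by move=> [p1 p2] [q1 q2]; rewrite /kip mulrDr; congr (_ + _); exact: srip_real.
Qed.

Let kipE (p : V) : inK p -> kip p p = ksq p.
Proof. by move=> [p1 p2]; rewrite /kip !(srip_l2sq hH). Qed.

Let kip_ge0 (p : V) : inK p -> 0 <= kip p p.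
Proof. by move=> hp; rewrite kipE // ksq_ge0. Qed.

Let bounded_lin (W : V -> V) : bounded_opK ip W ->
  forall (a : R[i]) p q, inK p -> inK q -> W (a *: p + q) = a *: W p + W q.
Proof. by case=> _ [lin _] a p q hp hq; exact: lin. Qed.

Let bounded_ksq (W : V -> V) : bounded_opK ip W ->
  exists M : R, 0 <= M /\ forall p, inK p -> ksq (W p) <= M * ksq p.
Proof.
case=> hin [_ [M hM]]; exists (M ^+ 2); split=> [|p hp]; first exact: sqr_ge0.
rewrite -!(knorm_sqr hH) //; last exact: hin.
by apply: sqr_le (hM p hp); exact: sqrtr_ge0.
Qed.

Let lin_sum (F : V -> V) (n : nat) (y : nat -> V) :
  (forall (a : R[i]) p q, inK p -> inK q -> F (a *: p + q) = a *: F p + F q) ->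
  (forall k, inK (y k)) ->
  inK (\sum_(k < n) y k) /\ F (\sum_(k < n) y k) = \sum_(k < n) F (y k).
Proof.
move=> F_lin hy.
have FD p q : inK p -> inK q -> F (p + q) = F p + F q.
  by move=> hp hq; rewrite -[p in LHS]scale1r F_lin // scale1r.
have F0 : F 0 = 0 by apply: (addrI (F 0)); rewrite -FD ?addr0.
elim: n => [|n [IH1 IH2]]; first by rewrite !big_ord0.
rewrite !big_ord_recr /= FD // IH2; split => //.
by rewrite -[X in X + _]scale1r; exact: inK_lin.
Qed.

Let lin_scale (F : V -> V) (a : R[i]) (p : V) :
  (forall (a : R[i]) p q, inK p -> inK q -> F (a *: p + q) = a *: F p + F q) ->
  inK p -> F (a *: p) = a *: F p.
Proof.
move=> F_lin hp; have [_] := @lin_sum F 0 (fun=> 0) F_lin (fun=> inK0).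
by rewrite !big_ord0 => F0; rewrite -[a *: p]addr0 F_lin // F0 addr0.
Qed.

Lemma similar_weighted : similar_to_contraction ip (RG G) ->
  exists A : R, forall N, \sum_(k < N) k.+1%:R ^+ 2 * sqmod (alpha k) <= A.
Proof.
move=> [W [Wi [bW bWi WK contr]]].
have [M1 [M1_ge0 hM1]] := bounded_ksq bW; have [M2 [M2_ge0 hM2]] := bounded_ksq bWi.
have inW : forall p, inK p -> inK (W p) by case: bW.
have inWi : forall p, inK p -> inK (Wi p) by case: bWi.
have inRG p : inK p -> inK (RG G p) by exact: (inK_RG hH car alpha_l2).
pose T (p : V) : V := W (RG G (Wi p)).
have inT p : inK p -> inK (T p) by move=> hp; apply/inW/inRG/inWi.
have T_lin (a : R[i]) (p q : V) : inK p -> inK q -> T (a *: p + q) = a *: T p + T q.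
  move=> hp hq; rewrite /T (bounded_lin bWi) // -(bounded_lin bW) //; try exact/inRG/inWi.
  by congr W; apply: (RG_lin hH car alpha_l2); exact: inWi.
have T_contr p : inK p -> kip (T p) (T p) <= kip p p.
  move=> hp; rewrite !kipE //; last exact: inT.
  rewrite -!(knorm_sqr hH) //; last exact: inT.
  by apply: lerXn2r; rewrite ?nnegrE ?sqrtr_ge0 //; exact: contr.
have iterT n p : inK p -> iter n T (W p) = W (iter n (RG G) p) /\ inK (iter n (RG G) p).
  move=> hp; elim: n => [//|n [IH hn]] /=; split; last exact: inRG.
  by rewrite IH /T (WK _ hn).2.
(* [M1] and [M2] bound the squared norms of [W] and its inverse, [2] is from the Clifford bound for
   contractions, [4] from [clifford_lower_bound]. *)
exists (4 * (2 * M1 * M2)) => N; rewrite -sum_beta.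
have [I [pi [eps [h [hpi hg h_gt0]]]]] := clifford_model hH car N x0_neq0.
apply: (clifford_lower_bound hH car hpi hg h_gt0); last by rewrite !mulr_ge0.
pose b n := conjc (beta n).
pose d (u : H) : V := (fun=> 0, delta 0 u).
have ind u : inK (d u) by exact: inK_delta.
have inWd t : inK (W (d (h t))) by exact: inW.
(* On the family [W (d (h t))] the matrix [D_n] acts as on [h], hence through [g n]. The Clifford
   bound for [T] thus controls [Z], which turns out to be [W] of a sum of powers of [RG G]. *)
pose Z t : V := \sum_(n < N) iter n T (b n *: ((-1) ^+ eps n t *: (W (d (h (pi n t))) : V))).
set B := \sum_(k < N) sqmod _.
have B0 : 0 <= B by apply: sumr_ge0 => k _; exact: sqmod_ge0.
have hZ : \sum_t kip (Z t) (Z t) <= 2 * B * \sum_t kip (W (d (h t))) (W (d (h t))).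
  have -> : B = \sum_(n < N) sqmod (b n) by apply: eq_bigr => n _; rewrite sqmod_conj.
  exact: (contraction_clifford_bound inK0 inK_lin kipDl kipC kipZ kip_real kip_ge0
    inT T_lin T_contr hpi b inWd).
pose u n t := b n *: g n (h t).
pose S t : V := \sum_(n < N) iter n (RG G) (d (u n t)).
have hiter n t : inK (iter n (RG G) (d (u n t))) by have [] := iterT n _ (ind (u n t)).
have RG_linV (a : R[i]) (p q : V) : inK p -> inK q ->
    RG G (a *: p + q) = a *: (RG G p : V) + (RG G q : V).
  exact: (RG_lin hH car alpha_l2).
have inS t : inK (S t).
  by have [] := lin_sum N RG_linV (fun n => hiter n t).
have ZE t : Z t = W (S t).
  have [_ ->] := lin_sum N (bounded_lin bW) (fun n => hiter n t).
  apply: eq_bigr => n _; rewrite -(iterT n _ (ind (u n t))).1; congr (iter n T _).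
  rewrite -!(lin_scale _ (bounded_lin bW)) //; last by rewrite -[_ *: _]addr0; exact: inK_lin.
  congr W; rewrite /u -hg //; congr pair; apply/funext => i /=.
    by rewrite !scaler0.
  by rewrite /delta /GRing.scale /=; case: ifP => //; rewrite !scaler0.
(* One further application of [RG G] raises the powers from [k] to [k + 1], whose coordinate 0
   carries [beta k]; the factor [conjc (beta k)] comes from [u]. *)
have vE t : \sum_(k < N) (beta k * conjc (beta k)) *: C k (g k (h t)) = (RG G (S t)).1 0%N.
  have [_ ->] := lin_sum N RG_linV (fun n => hiter n t).
  rewrite (big_morph (fun p : V => p.1 0%N) (id1 := 0) (op1 := +%R)) //.
  apply: eq_bigr => k _; rewrite -iterS (iter_RG hH car) /= add0n -/(beta k).
  by rewrite (carZ car) scalerA.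
(* The extra power costs only [M2], for undoing [W]: [W (RG G (S t)) = T (Z t)] and [T] is a
   contraction. *)
have key t : sqn (\sum_(k < N) (beta k * conjc (beta k)) *: C k (g k (h t)))
    <= M2 * kip (Z t) (Z t).
  have inRS := inRG _ (inS t).
  rewrite vE; apply: le_trans (_ : ksq (RG G (S t)) <= _).
    apply: le_trans (sqn_le_l2sq hH 0 inRS.1) _.
    by rewrite lerDl (l2sq_ge0 hH inRS.2).
  rewrite -{1}(WK _ inRS).2; apply: le_trans (hM2 _ (inW _ inRS)) _.
  rewrite ler_wpM2l // ZE -kipE; last exact: inW.
  have -> : W (RG G (S t)) = T (W (S t)) by rewrite /T (WK _ (inS t)).2.
  by apply: T_contr; exact: inW.
apply: le_trans (ler_sum _ (fun t _ => key t)) _.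
rewrite -mulr_sumr; apply: le_trans (ler_wpM2l M2_ge0 hZ) _.
have hW : \sum_t kip (W (d (h t))) (W (d (h t))) <= M1 * \sum_t sqn (h t).
  rewrite mulr_sumr; apply: ler_sum => t _; rewrite kipE; last exact: inW.
  by apply: le_trans (hM1 _ (ind (h t))) _; rewrite -(knorm_sqr hH) // knorm_delta.
apply: le_trans (_ : M2 * (2 * B * (M1 * \sum_t sqn (h t))) <= _).
  by rewrite ler_wpM2l // ler_wpM2l // mulr_ge0.
by rewrite le_eqVlt; apply/orP; left; apply/eqP; ring.
Qed.

End Equivalence.

(** * Specialization to [C_n = Lambda (e n)] *)

Theorem theorem6p1 (R : realType) (H : lmodType R[i]) (ip : H -> H -> R[i])
  (e : nat -> H) (Lambda Lstar : H -> H -> H) (alpha : nat -> R[i]) :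
  is_hilbert ip ->
  orthonormal_basis ip e ->
  (forall u, bounded_opH ip (Lambda u)) ->
  (forall v, is_adjoint ip (Lambda v) (Lstar v)) ->
  CAR ip Lambda Lstar ->
  l2C alpha ->
  similar_to_contraction ip (RG (Gamma ip alpha (fun n => Lambda (e n))))
  <-> quad_near_modH ip (RG (Gamma ip alpha (fun n => Lambda (e n)))).
Proof.
move=> hH [orth _] bounded adj [anti rel] alpha_l2.
have car : car_family ip (fun n => Lambda (e n)) (fun n => Lstar (e n)).
  split=> [i|i|i j x|i j x]; first by case: (bounded (e i)).
  - exact: adj.
  - exact: anti.
  - by rewrite rel orth.
(* A unit vector is nonzero, so it can start the Clifford model. *)
have e0 : e 0%N <> 0.
  move=> e0; have := orth 0%N 0%N; rewrite e0 => /(congr1 (@complex.Re R)) /eqP.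
  by rewrite -/(rip ip 0 0) (rip0l hH) /= eq_sym oner_eq0.
split.
- by move=> /(similar_weighted hH car alpha_l2 e0) [A]; exact: (weighted_quad_near hH car).
- move=> /(quad_near_weighted hH car alpha_l2 e0) [A].
  exact: (weighted_similar hH car alpha_l2).
Qed.
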